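(* Let $\mathsf{k}$ be an infinite field with $\operatorname{char}(\mathsf{k})=0$, let $d\ge 2$ be an integer, and let $n\gg 0$ (i.e. $n$ is sufficiently large depending on $d$). If $I=(f)_{\mathfrak{S}_n}$ is a general principal symmetric ideal of $R=\mathsf{k}[x_1,\dots,x_n]$ generated by a homogeneous polynomial $f$ of degree $d$, then the quotient algebra $A=R/I$ is a $d$-extremely narrow algebra. Moreover, the socle polynomial of $A$ is $$\left(\binom{n+d-2}{d-1}-(n-1)P(d)-P(d-1)+n-1\right)z^{d-1}+(P(d)-1)z^d .$$
   Context: $R$ is standard graded; $\mathfrak{S}_n$ acts by $\sigma\cdot f(x_1,\dots,x_n)=f(x_{\sigma(1)},\dots,x_{\sigma(n)})$, and $(f)_{\mathfrak{S}_n}=(\sigma\cdot f:\sigma\in\mathfrak{S}_n)$. $P(d)$ is the number of partitions of $d$. General: let $N=\binom{n+d-1}{d}$, let $m_1,\dots,m_N$ be the degree $d$ monomials of $R$, and for $c\in\mathbb{P}^{N-1}$ put $f_c=\sum_i c_im_i$. A general principal symmetric ideal generated in degree $d$ satisfies a property if there is a nonempty Zariski-open $U\subseteq\mathbb{P}^{N-1}$ such that $(f_c)_{\mathfrak{S}_n}$ satisfies it for all $c\in U$. Let $S=\operatorname{Hom}_{\mathsf{k}}(R,\mathsf{k})$ be the graded dual, $S_{-j}=\operatorname{Hom}_{\mathsf{k}}(R_j,\mathsf{k})$, with basis $y_1^{(e_1)}\cdots y_n^{(e_n)}$ dual to the monomials $x_1^{e_1}\cdots x_n^{e_n}$; $R$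 acts on $S$ by contraction: $x_1^{d_1}\cdots x_n^{d_n}\circ y_1^{(e_1)}\cdots y_n^{(e_n)}=y_1^{(e_1-d_1)}\cdots y_n^{(e_n-d_n)}$ if all $e_i\ge d_i$, and $0$ otherwise. For a homogeneous ideal $I$, $I^\perp=\{g\in S: f\circ g=0\ \forall f\in I\}$. $t(I)$ is the least degree $i$ with $I_i\ne0$. For $A=R/I$ artinian, $\operatorname{Soc}(A)$ is the annihilator in $A$ of $(x_1,\dots,x_n)A$, $s(A)=\max\{i:\operatorname{Soc}(A)_i\neq0\}$, and the socle polynomial is $\sum_i\dim_{\mathsf{k}}\operatorname{Soc}(A)_iz^i$. For $F_1,\dots,F_a\in S_{-d}$ let $L_{F_1,\dots,F_a}=\{(\ell_1,\dots,\ell_a)\in R_1^a:\sum_i\ell_i\circ F_i=0\}$. The algebra $A=R/I$ is $d$-extremely narrow if it is artinian with $s(A)=t(I)=d$ and there exist a basis $F_1,\dots,F_a$ of $(I^\perp)_{-d}$ and $x\in R_1$ such that $L_{F_1,\dots,F_a}\subseteq xR_0^a=\{(c_1x,\dots,c_ax):c_i\in\mathsf{k}\}$. *)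

(* Defs.v *)
From HB Require Import structures.
From mathcomp Require Import all_boot all_order all_algebra all_fingroup.
From mathcomp Require Import generic_quotient ring_quotient mpoly.
From Stdlib Require Import ClassicalEpsilon.

Set Implicit Arguments.
Unset Strict Implicit.
Unset Printing Implicit Defensive.

Import GRing.Theory.
Local Open Scope ring_scope.
Local Open Scope quotient_scope.

Record ideal (R : comPzRingType) := Ideal {
  ideal_pred :> R -> Prop;
  ideal0 : ideal_pred 0;
  idealD : forall u v, ideal_pred u -> ideal_pred v -> ideal_pred (u + v);
  idealMl : forall a u, ideal_pred u -> ideal_pred (a * u)
}.

Definition artinian (A : comPzRingType) : Prop :=
  forall J : nat -> ideal A,
    (forall m a, J m.+1 a -> J m a) ->
    exists m0, forall m, (m0 <= m)%N -> forall a, J m a <-> J m0 a.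

Section Bases.
Variables (k : fieldType) (V : lmodType k).

Definition is_basis (W : V -> Prop) (a : nat) (b : 'I_a -> V) : Prop :=
  [/\ forall i, W (b i),
      forall c : 'I_a -> k, \sum_i c i *: b i = 0 -> forall i, c i = 0
    & forall v, W v -> exists c : 'I_a -> k, v = \sum_i c i *: b i].

Definition has_dim (W : V -> Prop) (m : nat) : Prop :=
  exists b : 'I_m -> V, is_basis W b.

End Bases.

(* [{ideal_quot _}] is only available for proper ideals with a boolean
   membership test; here [I] is arbitrary, so the ring structure is put on the
   additive quotient [Quotient.quot] and may be the zero ring. *)
Section QuotientRing.
Variables (k : fieldType) (n : nat).
Local Notation R := {mpoly k[n]}.

Definition ideal_mem (I : ideal R) : R -> bool :=
  fun u => if excluded_middle_informative (I u) then true else false.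

Lemma ideal_memP (I : ideal R) u : reflect (I u) (ideal_mem I u).
Proof.
by rewrite /ideal_mem; case: excluded_middle_informative => h; constructor.
Qed.

Fact ideal_mem_zmod (I : ideal R) : zmod_closed (ideal_mem I).
Proof.
split=> [|u v /ideal_memP Iu /ideal_memP Iv]; first exact/ideal_memP/ideal0.
by apply/ideal_memP/idealD => //; rewrite -mulN1r; apply: idealMl.
Qed.

HB.instance Definition _ (I : ideal R) :=
  GRing.isZmodClosed.Build R (ideal_mem I) (ideal_mem_zmod I).

Local Notation quot I :=
  (Quotient.quot (GRing.ZmodClosed.clone R (ideal_mem I) _)).
Definition quot_ring (I : ideal R) : Type := quot I.

Section Structure.
Variable I : ideal R.
Local Notation A := (quot_ring I).

HB.instance Definition _ := GRing.Zmodule.on A.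

Definition qpi (u : R) : A := \pi_(quot I) u.
Definition qrepr (a : A) : R := @repr _ (quot I) a.

Lemma qreprK a : qpi (qrepr a) = a.
Proof. exact: reprK. Qed.

Lemma qpiP u v : qpi u = qpi v <-> I (u - v).
Proof.
rewrite /qpi; split=> [/eqP|Iuv]; last apply/eqP.
  by rewrite -Quotient.idealrBE => /ideal_memP.
by rewrite -Quotient.idealrBE; apply/ideal_memP.
Qed.

Lemma qpiD u v : qpi (u + v) = qpi u + qpi v.
Proof. exact: (raddfD (\pi_(quot I))). Qed.

Definition qone : A := qpi 1.
Definition qmul (a b : A) : A := qpi (qrepr a * qrepr b).
Definition qscale (c : k) (a : A) : A := qpi (c *: qrepr a).

Lemma qrepr_pi u : I (qrepr (qpi u) - u).
Proof. by apply/qpiP; rewrite qreprK. Qed.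

Lemma qpiM u v : qpi (u * v) = qmul (qpi u) (qpi v).
Proof.
symmetry; apply/qpiP; set u' := qrepr _; set v' := qrepr _.
have -> : u' * v' - u * v = v' * (u' - u) + u * (v' - v).
  by rewrite !mulrBr [v' * u']mulrC [v' * u]mulrC addrA subrK.
by apply: idealD; apply: idealMl; apply: qrepr_pi.
Qed.

Lemma qpiZ c u : qpi (c *: u) = qscale c (qpi u).
Proof.
by symmetry; apply/qpiP; rewrite -scalerBr -mul_mpolyC; apply/idealMl/qrepr_pi.
Qed.

Fact qmulA : associative qmul.
Proof.
move=> a b c; rewrite -[a]qreprK -[b]qreprK -[c]qreprK.
by rewrite -!qpiM mulrA.
Qed.

Fact qmulC : commutative qmul.
Proof. by move=> a b; rewrite /qmul mulrC. Qed.

Fact qmul1 : left_id qone qmul.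
Proof. by move=> a; rewrite -[a]qreprK /qone -qpiM mul1r. Qed.

Fact qmulDl : left_distributive qmul +%R.
Proof.
move=> a b c; rewrite -[a]qreprK -[b]qreprK -[c]qreprK.
by rewrite -qpiD -!qpiM -qpiD mulrDl.
Qed.

HB.instance Definition _ :=
  GRing.Zmodule_isComPzRing.Build A qmulA qmulC qmul1 qmulDl.

Fact qscaleA c c' a : qscale c (qscale c' a) = qscale (c * c') a.
Proof. by rewrite -[a]qreprK -!qpiZ scalerA. Qed.

Fact qscale1 : left_id 1 qscale.
Proof. by move=> a; rewrite -[a]qreprK -qpiZ scale1r. Qed.

Fact qscaleDr : right_distributive qscale +%R.
Proof.
move=> c a b; rewrite -[a]qreprK -[b]qreprK.
by rewrite -qpiD -!qpiZ -qpiD scalerDr.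
Qed.

Fact qscaleDl a : {morph qscale^~ a : c c' / c + c'}.
Proof. by move=> c c'; rewrite -[a]qreprK -!qpiZ -qpiD scalerDl. Qed.

HB.instance Definition _ :=
  GRing.Zmodule_isLmodule.Build k A qscaleA qscale1 qscaleDr qscaleDl.

End Structure.
End QuotientRing.

Section GradedQuotient.
Variables (k : fieldType) (n : nat).
Local Notation R := {mpoly k[n]}.
Implicit Types I : ideal R.

Definition quot_comp I (i : nat) (a : quot_ring I) : Prop :=
  exists2 u : R, u \is i.-homog & a = qpi I u.

Definition in_socle I (a : quot_ring I) : Prop :=
  forall b : 'I_n -> quot_ring I, a * (\sum_j qpi I 'X_j * b j) = 0.

Definition socle_comp I (i : nat) (a : quot_ring I) : Prop :=
  in_socle a /\ quot_comp i a.

(* t(I) = t *)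
Definition is_initial_degree I (t : nat) : Prop :=
  (exists u : R, [/\ I u, u \is t.-homog & u != 0]) /\
  (forall i (u : R), I u -> u \is i.-homog -> u != 0 -> (t <= i)%N).

(* s(R/I) = s *)
Definition is_max_socle_degree I (s : nat) : Prop :=
  (exists2 a : quot_ring I, socle_comp s a & a != 0) /\
  (forall i (a : quot_ring I), socle_comp i a -> a != 0 -> (i <= s)%N).

(* Integer coefficients, so that formulas with subtractions can be compared. *)
Definition is_socle_poly I (p : {poly int}) : Prop :=
  forall i, exists2 m : nat, has_dim (@socle_comp I i) m & p`_i = m%:Z.

(* An element of the graded dual S is encoded by a polynomial, 'X_[e] standing
   for the divided power monomial y^(e), the functional dual to x^e; only the
   module structure of {mpoly k[n]} is used on that side, and S_{-j} is the
   span of the 'X_[e] with mdeg e = j. *)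
Definition contract (f g : R) : R :=
  \sum_(m <- msupp f) \sum_(e <- msupp g | (m <= e)%MM)
    (f@_m * g@_e) *: 'X_[(e - m)%MM].

Definition perp I (g : R) : Prop := forall f : R, I f -> contract f g = 0.

Definition perp_comp I (j : nat) (g : R) : Prop := perp I g /\ g \is j.-homog.

Definition extremely_narrow (d : nat) I : Prop :=
  [/\ artinian (quot_ring I), is_max_socle_degree I d, is_initial_degree I d
    & exists (a : nat) (F : 'I_a -> R) (x : R),
      [/\ is_basis (perp_comp I d) F, x \is 1.-homog
        & forall l : 'I_a -> R, (forall i, l i \is 1.-homog) ->
            \sum_i contract (l i) (F i) = 0 ->
            exists c : 'I_a -> k, forall i, l i = c i *: x]].

End GradedQuotient.

Section SymmetricIdeal.
Variables (k : fieldType) (n : nat).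
Local Notation R := {mpoly k[n]}.
Variable f : R.

Definition sym_ideal_pred (g : R) : Prop :=
  exists r : 'S_n -> R, g = \sum_s r s * msym s f.

Fact sym_ideal0 : sym_ideal_pred 0.
Proof. by exists (fun=> 0); rewrite big1 // => s _; rewrite mul0r. Qed.

Fact sym_idealD u v :
  sym_ideal_pred u -> sym_ideal_pred v -> sym_ideal_pred (u + v).
Proof.
move=> [r ->] [r' ->]; exists (fun s => r s + r' s).
by rewrite -big_split; apply: eq_bigr => s _; rewrite mulrDl.
Qed.

Fact sym_idealMl a u : sym_ideal_pred u -> sym_ideal_pred (a * u).
Proof.
move=> [r ->]; exists (fun s => a * r s).
by rewrite mulr_sumr; apply: eq_bigr => s _; rewrite mulrA.
Qed.

Definition sym_ideal : ideal R := Ideal sym_ideal0 sym_idealD sym_idealMl.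

End SymmetricIdeal.

Definition monomials (n d : nat) : seq 'X_{1..n} :=
  [seq s2m t | t : d.-tuple 'I_n <- enum (basis n d)].

Lemma uniq_monomials n d : uniq (monomials n d).
Proof. exact: uniq_basis. Qed.

Lemma mem_monomials n d m : (m \in monomials n d) = (mdeg m == d).
Proof. by rewrite basis_cover. Qed.

Lemma size_monomials n d :
  (0 < n)%N -> size (monomials n d) = 'C((n + d).-1, d).
Proof. by case: n => // n _; rewrite size_basis addSn addnC. Qed.

Section General.
Variable k : fieldType.

(* Points of P^(N-1) are given by nonzero coordinate vectors; openness being
   expressed with homogeneous polynomials, it does not depend on the scaling. *)
Definition proj_point (N : nat) (c : 'I_N -> k) : Prop := exists i, c i != 0.

Definition zariski_open (N : nat) (U : ('I_N -> k) -> Prop) : Prop :=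
  exists E : {mpoly k[N]} -> Prop,
    (forall p, E p -> exists e : nat, p \is e.-homog) /\
    (forall c, proj_point c -> (U c <-> exists2 p, E p & p.@[c] != 0)).

Definition general_form (n d : nat) (c : 'I_('C((n + d).-1, d)) -> k) :
    {mpoly k[n]} :=
  \sum_i c i *: 'X_[nth 0%MM (monomials n d) i].

Definition general_psi (n d : nat) (Q : ideal {mpoly k[n]} -> Prop) : Prop :=
  exists U : ('I_('C((n + d).-1, d)) -> k) -> Prop,
    [/\ zariski_open U, exists2 c, proj_point c & U c
      & forall c, proj_point c -> U c -> Q (sym_ideal (general_form c))].

End General.

(* Partitions of d as nonincreasing sequences of length d, padded with zeros. *)
Definition npartitions (d : nat) : nat :=
  #|[set t : d.-tuple 'I_d.+1 |
      sorted geq (map val t) && (sumn (map val t) == d)]|.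

(* Main.v *)
(* Call type of a monomial its orbit under permutation of the variables, and let
   s : R_d -> k^P(d) add up coefficients over each type.  If f is a sum of
   monomials, one for each type, with disjoint supports (and nonzero
   coefficients), then moving one variable of a monomial of f to an unused
   variable changes no other term of f, so the orbit of f spans the differences
   m - m' of monomials of the same type, that is, ker s.  This is a nonvanishing
   determinant condition, hence it holds for a general f, and then I_d is the
   preimage under s of the line spanned by s(f).  If moreover the coefficients
   of f do not add up to 0, all monomials of degree d + 1 lie in I.

   Dually, (I^perp)_{-d} consists of the symmetric elements orthogonal to f.  If
   G_1, ..., G_n are symmetric and sum_j x_j o G_j = 0, applying a transposition
   (p q) shows that the coefficients of G_p - G_q are all equal; orthogonality to
   f then forces G_p = G_q.  This gives the narrowness, with x the sum of the
   variables, and reduces the dimension of R_1 o (I^perp)_{-d}, hence that of the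
   socle in degree d - 1, to the rank of x on (I^perp)_{-d}.  In the coinvariants
   x is injective, since R is a domain, so that x maps the symmetric elements of
   degree d onto those of degree d - 1; a general f is not orthogonal to its
   kernel, which is nonzero as P(d - 1) < P(d). *)

Require Import Defs.
From HB Require Import structures.
From mathcomp Require Import all_boot all_order all_algebra all_fingroup.
From mathcomp Require Import mpoly zify ring.
From Stdlib Require Import Classical.

Set Implicit Arguments.
Unset Strict Implicit.
Unset Printing Implicit Defensive.

Import GRing.Theory.

Local Notation "m # s" := [multinom m (s i) | i < _]
  (at level 40, left associativity, format "m # s").

(** * Partitions and orbits of monomials *)

Section Partitions.
Local Open Scope nat_scope.
Variable d : nat.
Implicit Types l : 'I_(npartitions d).

Definition part_seq l : seq nat := map val (enum_val l).

Lemma part_seqP l :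
  [/\ sorted geq (part_seq l), sumn (part_seq l) = d & size (part_seq l) = d].
Proof.
have := enum_valP l; rewrite inE => /andP[? /eqP ?].
by split=> //; rewrite size_map size_tuple.
Qed.

Lemma part_seq_inj : injective part_seq.
Proof. by move=> l l' /(inj_map val_inj)/val_inj/enum_val_inj. Qed.

Lemma part_seq_surj (s : seq nat) :
  sorted geq s -> sumn s = d -> size s = d -> exists l, part_seq l = s.
Proof.
move=> ss sum_s size_s.
have sz : size (map (inord : nat -> 'I_d.+1) s) == d by rewrite size_map size_s.
have vs : map val (map (inord : nat -> 'I_d.+1) s) = s.
  rewrite -map_comp -[RHS]map_id; apply/eq_in_map => x xs /=.
  rewrite inordK // ltnS -sum_s.
  by move: xs => /perm_to_rem/perm_sumn ->; rewrite /= leq_addr.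
set A := [set t : d.-tuple 'I_d.+1 |
      sorted geq (map val t) && (sumn (map val t) == d)].
have tA : Tuple sz \in A by rewrite inE /= vs ss sum_s eqxx.
exists (enum_rank_in tA (Tuple sz) : 'I_(npartitions d)).
by rewrite /part_seq enum_rankK_in.
Qed.

Lemma npartitions_gt0 : 0 < npartitions d.
Proof.
have [l _] : exists l, part_seq l = nseq d 1; last exact: leq_ltn_trans (ltn_ord l).
apply: part_seq_surj; rewrite ?sumn_nseq ?size_nseq ?mul1n //.
by case: (d) => //= k; elim: k.
Qed.

End Partitions.

(** [grow] adds 1 to the largest part and pads with 0. It is injective, and it misses the partition
    of [d] into ones because its values end in 0. *)
Lemma npartitions_pred_lt (d : nat) : (2 <= d)%N ->
  (npartitions (d - 1) < npartitions d)%N.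
Proof.
move=> hd.
pose grow (s : seq nat) := (head 0 s).+1 :: rcons (behead s) 0.
have growP (l : 'I_(npartitions (d - 1))) :
    exists l' : 'I_(npartitions d), part_seq l' == grow (part_seq l).
  have [ss sum_s size_s] := part_seqP l.
  case E: (part_seq l) ss sum_s size_s => [|x s] /= ss sum_s size_s; first lia.
  have [|||l' l'E] := @part_seq_surj d (grow (x :: s)); last by exists l'; apply/eqP.
  - rewrite /grow /=; case: s ss {E sum_s size_s} => //= y s /andP[yx ss].
    rewrite (leq_trans yx) //=.
    by elim: s y ss {yx} => //= z s IH y /andP[-> /IH].
  - by rewrite /grow /= sumn_rcons; lia.
  - by rewrite /grow /= size_rcons; lia.
pose g l := xchoose (growP l).
have gE l : part_seq (g l) = grow (part_seq l) by apply/eqP/(xchooseP (growP l)).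
have g_inj : injective g.
  move=> l l' /(congr1 (@part_seq d)); rewrite !gE => -[h].
  have [_ _ s1] := part_seqP l; have [_ _ s2] := part_seqP l'.
  move=> /rcons_inj[t]; apply: part_seq_inj.
  case: (part_seq l) s1 h t => [|x s] /= s1; first lia.
  case: (part_seq l') s2 => [|x' s'] /= s2; first lia.
  by move=> -> ->.
have [l1 l1E] : exists l1, part_seq (d := d) l1 = nseq d 1%N.
  apply: part_seq_surj; rewrite ?sumn_nseq ?size_nseq ?mul1n //.
  by case: (d) => //= k; elim: k.
have : (#|codom g| < #|'I_(npartitions d)|)%N.
  rewrite -[X in (_ < X)%N]cardsT.
  apply: leq_trans (_ : #|[set~ l1]|.+1 <= _)%N; last first.
    by rewrite cardsC1 cardsT card_ord; have := npartitions_gt0 d; lia.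
  rewrite ltnS; apply: subset_leq_card; apply/subsetP => _ /codomP[l ->].
  rewrite !inE; apply/negP => /eqP /(congr1 (@part_seq d)); rewrite gE l1E.
  move=> /(congr1 (last 0%N)); rewrite /grow /= last_rcons.
  by case: d hd {l1 l1E gE g_inj g growP l} => // k _ /=; elim: k.
by rewrite card_codom // !card_ord.
Qed.

Lemma mnm_split n (m : 'X_{1..n}) i : mdeg m = i.+1 ->
  exists j, exists2 m', m = (m' + U_(j))%MM & mdeg m' = i.
Proof.
move=> md; have [j mj] : exists j, m j != 0%N.
  apply/existsP; apply: contra_eqT md; rewrite negb_exists => /forallP h.
  by rewrite mdegE big1 // => j _; apply/eqP; rewrite -[_ == _]negbK.
exists j; exists (m - U_(j))%MM; first by rewrite submK // lep1mP.
have := congr1 (@mdeg n) (submK (etrans (lep1mP j m) mj)).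
by rewrite mdegD mdeg1 md addn1 => -[].
Qed.

Section Types.
Local Open Scope nat_scope.
Variables (n d : nat).
Implicit Types (m : 'X_{1..n}) (s : 'S_n) (l : 'I_(npartitions d)).

Lemma perm_eq_mnm m m' : perm_eq m m' -> exists s, m' = m#s.
Proof.
rewrite perm_sym => /tuple_permP[s E]; exists s; apply/mnmP => i.
rewrite mnmE mnm_tnth (tnth_nth 0) E.
by rewrite -(tnth_nth 0 [tuple tnth m (s i) | i < n]) tnth_mktuple -mnm_tnth.
Qed.

Lemma mnm_perm_eq m s : perm_eq (m#s) m.
Proof.
by apply/tuple_permP; exists s.
Qed.

Definition has_type m l := perm_eq m (part_seq l ++ nseq (n - d) 0).

(** The default value is reached only if [n < d] or [mdeg m] differs from [d]. *)
Definition mtype m : 'I_(npartitions d) :=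
  odflt (Ordinal (npartitions_gt0 d)) [pick l | has_type m l].

(* The supports of these representatives are pairwise disjoint. *)
Definition mrep l : 'X_{1..n} :=
  [multinom nth 0 (nseq (l * d) 0 ++ part_seq l) i | i < n].

Lemma sumn_mdeg m : sumn m = mdeg m.
Proof. by rewrite sumnE /mdeg. Qed.

Lemma has_type_uniq m l l' : has_type m l -> has_type m l' -> l = l'.
Proof.
rewrite /has_type perm_sym => h h'.
have {h h'} := perm_trans h h' => h; apply: part_seq_inj.
have [s1 _ z1] := part_seqP l; have [s2 _ z2] := part_seqP l'.
have {}h : perm_eq (part_seq l) (part_seq l').
  by move: h; rewrite perm_cat2r.
by apply: (sorted_eq _ _ s1 s2 h); [exact: rev_trans leq_trans|move=> x y; rewrite andbC => /anti_leq].
Qed.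

(** Sort the exponents in decreasing order: at most [d] of them are nonzero, as more would exceed
    the degree, so everything after the first [d] entries is zero padding. *)
Lemma has_type_ex m : d <= n -> mdeg m = d -> exists l, has_type m l.
Proof.
move=> dn md.
have ps : perm_eq (sort geq m) m by rewrite perm_sort.
have so : sorted geq (sort geq m) by apply: sort_sorted => x y; apply: leq_total.
have su : sumn (sort geq m) = d by rewrite (perm_sumn ps) sumn_mdeg.
have sz : size (sort geq m) = n by rewrite size_sort size_tuple.
have sz0 : size (take d (sort geq m)) = d by rewrite size_take sz; case: ltnP => //; lia.
have z : drop d (sort geq m) = nseq (n - d) 0.
  apply: (@eq_from_nth _ 0); first by rewrite size_drop sz size_nseq.
  move=> i; rewrite size_drop sz => hi; rewrite nth_nseq hi nth_drop.
  apply/eqP; rewrite -leqn0 leqNgt; apply/negP => pos.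
  have geP j : j <= d + i -> 0 < nth 0 (sort geq m) j.
    move=> hj; apply: leq_trans pos _.
    have T : transitive geq by exact: rev_trans leq_trans.
    have Rf : reflexive geq by exact: leqnn.
    by apply: (sorted_leq_nth T Rf 0 so); rewrite ?inE ?sz //; lia.
  have : d.+1 <= sumn (take d.+1 (sort geq m)).
    have sz1 : size (take d.+1 (sort geq m)) = d.+1 by rewrite size_take sz; case: ltnP => //; lia.
    rewrite -{1}[d.+1]sz1 -sum1_size sumnE big_seq [X in _ <= X]big_seq; apply: leq_sum => x.
    move=> /(nthP 0)[j]; rewrite sz1 => hj <-; rewrite nth_take //.
    by apply: geP; lia.
  by move: su; rewrite -{1}(cat_take_drop d.+1 (sort geq m)) sumn_cat; lia.
have su0 : sumn (take d (sort geq m)) = d.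
  by move: su; rewrite -{1}(cat_take_drop d (sort geq m)) z sumn_cat sumn_nseq mul0n addn0.
have so0 : sorted geq (take d (sort geq m)) by exact: take_sorted.
have [l lE] := part_seq_surj so0 su0 sz0.
by exists l; rewrite /has_type lE -z cat_take_drop perm_sym.
Qed.

Lemma mtype_eq m l : has_type m l -> mtype m = l.
Proof.
rewrite /mtype => h; case: pickP => [l' /= h'|/(_ l)]; last by rewrite h.
exact: has_type_uniq h' h.
Qed.

Lemma mtype_perm m s : mtype (m#s) = mtype m.
Proof.
rewrite /mtype; congr odflt; apply: eq_pick => l; rewrite /has_type /=.
by rewrite (permPl (mnm_perm_eq m s)).
Qed.

Lemma mtype_orbit m m' : d <= n -> mdeg m = d -> mdeg m' = d ->
  mtype m = mtype m' -> exists s, m' = m#s.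
Proof.
move=> dn md md'; have [l h] := has_type_ex dn md; have [l' h'] := has_type_ex dn md'.
rewrite (mtype_eq h) (mtype_eq h') => E; apply: perm_eq_mnm.
by apply: perm_trans h _; rewrite perm_sym E.
Qed.

Lemma mrep_supp l (i : 'I_n) : mrep l i != 0 -> l * d <= i < l * d + d.
Proof.
have [_ _ sz] := part_seqP l.
rewrite mnmE nth_cat size_nseq nth_nseq; case: ltnP => //= hi.
by case: (ltnP i (l * d + d)) => // h; rewrite nth_default // sz; lia.
Qed.

Lemma mrep_supp_disj l l' (i : 'I_n) : mrep l i != 0 -> mrep l' i != 0 -> l = l'.
Proof.
move=> /mrep_supp/andP[a b] /mrep_supp/andP[a' b']; apply/val_inj/eqP => /=.
have lt (x y : nat) : x * d <= i -> i < y * d + d -> x <= y.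
  move=> h h'; rewrite leqNgt; apply/negP => yx.
  by have := leq_mul2r d y.+1 x; rewrite yx orbT mulSnr => /idP; lia.
by rewrite eqn_leq; apply/andP; split; exact: lt.
Qed.

Hypothesis large : npartitions d * d <= n.

Lemma mrep_bound l : l * d + d <= n.
Proof. by apply: leq_trans large; rewrite -mulSnr leq_mul2r ltn_ord orbT. Qed.

Lemma mrep_has_type l : has_type (mrep l) l.
Proof.
have [_ _ sz] := part_seqP l; have := mrep_bound l => hb.
rewrite /has_type.
have -> : mrep l = nseq (l * d) 0 ++ part_seq l ++ nseq (n - (l * d + d)) 0 :> seq nat.
  apply: (@eq_from_nth _ 0).
    by rewrite size_tuple !size_cat !size_nseq sz; lia.
  move=> i; rewrite size_tuple => hi.
  rewrite -(mnm_nth _ _ (Ordinal hi)) mnmE catA [RHS]nth_cat.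
  case: ifP => // /negbT; rewrite -leqNgt => hs.
  by rewrite nth_default // nth_nseq if_same.
have -> : n - d = l * d + (n - (l * d + d)) by lia.
by rewrite nseqD perm_catCA.
Qed.

Lemma mtype_mrep l : mtype (mrep l) = l.
Proof. exact/mtype_eq/mrep_has_type. Qed.

Lemma mdeg_mrep l : mdeg (mrep l) = d.
Proof.
rewrite -sumn_mdeg (perm_sumn (mrep_has_type l)) sumn_cat sumn_nseq mul0n addn0.
by have [] := part_seqP l.
Qed.

End Types.

Local Open Scope ring_scope.

(** * Structure of the symmetric ideal *)

Section Coordinates.
Variables (k : fieldType) (n : nat).
Hypothesis n_gt0 : (0 < n)%N.
Local Notation R := {mpoly k[n]}.
Local Notation N i := 'C((n + i).-1, i).

Definition mon i (t : 'I_(N i)) : 'X_{1..n} := nth 0%MM (monomials n i) t.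

Lemma mdeg_mon i (t : 'I_(N i)) : mdeg (mon t) = i.
Proof.
by apply/eqP; rewrite -mem_monomials mem_nth // size_monomials.
Qed.

Lemma mon_inj i : injective (@mon i).
Proof.
move=> t t' /eqP; rewrite nth_uniq ?size_monomials ?uniq_monomials //.
by move=> /eqP/val_inj.
Qed.

Lemma mon_ex i m : mdeg m = i -> exists t : 'I_(N i), mon t == m.
Proof.
move=> /eqP; rewrite -mem_monomials => /(nthP 0%MM)[j].
by rewrite size_monomials // => hj <-; exists (Ordinal hj); apply/eqP.
Qed.

Lemma sum_mon_perm (V : nmodType) i (s : 'S_n) (F : 'X_{1..n} -> V) :
  \sum_(t < N i) F (mon t) = \sum_(t < N i) F (mon t # s).
Proof.
have ex (t : 'I_(N i)) : exists t' : 'I_(N i), mon t' == mon t # s.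
  by apply: mon_ex; rewrite mdeg_mperm mdeg_mon.
pose h t := xchoose (ex t); have hE t : mon (h t) = mon t # s.
  exact/eqP/(xchooseP (ex t)).
have h_inj : injective h.
  by move=> t t' /(congr1 (@mon i)); rewrite !hE => /mperm_inj/mon_inj.
by rewrite (reindex_inj h_inj); apply: eq_bigr => t _; rewrite hE.
Qed.

Definition vec i (u : R) : 'rV[k]_(N i) := \row_t u@_(mon t).
Definition pol i (v : 'rV[k]_(N i)) : R := \sum_t v 0 t *: 'X_[mon t].

Fact vec_is_linear i : linear (@vec i).
Proof. by move=> a u v; apply/rowP => t; rewrite !mxE mcoeffD mcoeffZ. Qed.
HB.instance Definition _ i :=
  GRing.isLinear.Build k R 'rV[k]_(N i) _ (@vec i) (@vec_is_linear i).

Fact pol_is_linear i : linear (@pol i).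
Proof.
move=> a u v; rewrite /pol scaler_sumr -big_split; apply: eq_bigr => t _.
by rewrite !mxE scalerDl scalerA.
Qed.
HB.instance Definition _ i :=
  GRing.isLinear.Build k 'rV[k]_(N i) R _ (@pol i) (@pol_is_linear i).

Lemma mcoeff_pol i (v : 'rV_(N i)) t : (pol v)@_(mon t) = v 0 t.
Proof.
rewrite raddf_sum (bigD1 t) //= mcoeffZ mcoeffX eqxx mulr1 big1 ?addr0 // => t' ne.
by rewrite mcoeffZ mcoeffX (inj_eq (@mon_inj i)) (negPf ne) mulr0.
Qed.

Lemma pol_homog i (v : 'rV_(N i)) : pol v \is i.-homog.
Proof. by apply: rpred_sum => t _; rewrite rpredZ // dhomogX /= mdeg_mon. Qed.

Lemma polK i : cancel (@pol i) (@vec i).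
Proof. by move=> v; apply/rowP => t; rewrite mxE mcoeff_pol. Qed.

Lemma vecK i u : u \is i.-homog -> pol (vec i u) = u.
Proof.
move=> hu; apply/mpolyP => m; have [md|md] := eqVneq (mdeg m) i.
  by have [t /eqP <-] := mon_ex md; rewrite mcoeff_pol mxE.
by rewrite (dhomog_nemf_coeff hu md) (dhomog_nemf_coeff (pol_homog _) md).
Qed.

Lemma general_formE i (c : 'I_(N i) -> k) : general_form c = pol (\row_t c t).
Proof. by apply: eq_bigr => t _; rewrite mxE. Qed.

(** The map [s] onto type sums, as a matrix multiplying row vectors on the right. Its transpose
    spreads a vector on types over the monomials, which gives the symmetric elements. *)
Definition typemx i : 'M[k]_(N i, npartitions i) :=
  \matrix_(t, l) (mtype i (mon t) == l)%:R.

Lemma mul_typemxE i (v : 'rV_(N i)) l :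
  (v *m typemx i) 0 l = \sum_(t | mtype i (mon t) == l) v 0 t.
Proof.
rewrite mxE [RHS]big_mkcond; apply: eq_bigr => t _; rewrite mxE.
by case: eqP; rewrite ?mulr1 ?mulr0.
Qed.

Lemma mul_typemx_trE i (c : 'rV_(npartitions i)) t :
  (c *m (typemx i)^T) 0 t = c 0 (mtype i (mon t)).
Proof.
rewrite mxE (bigD1 (mtype i (mon t))) //= !mxE eqxx mulr1 big1 ?addr0 // => l ne.
by rewrite !mxE eq_sym (negPf ne) mulr0.
Qed.

Lemma sum_mul_typemx i (v : 'rV_(N i)) :
  \sum_l (v *m typemx i) 0 l = \sum_t v 0 t.
Proof.
rewrite [RHS](partition_big (fun t => mtype i (mon t)) predT) //=.
by apply: eq_bigr => l _; rewrite mul_typemxE.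
Qed.

Lemma vec_msym_typemx i (s : 'S_n) u :
  vec i (msym s u) *m typemx i = vec i u *m typemx i.
Proof.
apply/rowP => l; rewrite !mul_typemxE big_mkcond [RHS]big_mkcond /=.
pose F m := if mtype i m == l then u@_m else 0.
transitivity (\sum_(t < N i) F (mon t # s)).
  by apply: eq_bigr => t _; rewrite /F mtype_perm mxE mcoeff_sym.
by rewrite -sum_mon_perm; apply: eq_bigr => t _; rewrite /F mxE.
Qed.

Lemma vec_X_typemx i (m : 'X_{1..n}) : mdeg m = i ->
  vec i 'X_[m] *m typemx i = delta_mx 0 (mtype i m).
Proof.
move=> md; have [t0 /eqP t0E] := mon_ex md; apply/rowP => l.
rewrite mul_typemxE [RHS]mxE /= big_mkcond (bigD1 t0) //= mxE t0E mcoeffX eqxx eq_sym.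
rewrite big1 ?addr0 => [|t ne]; first by case: eqP.
by rewrite mxE mcoeffX -t0E (inj_eq (@mon_inj i)) (eq_sym t0) (negPf ne) if_same.
Qed.

End Coordinates.

Section Ideals.
Variables (R : comPzRingType) (I : ideal R).

Lemma idealN u : I u -> I (- u).
Proof. by rewrite -mulN1r; apply: idealMl. Qed.

Lemma idealB u v : I u -> I v -> I (u - v).
Proof. by move=> Iu Iv; apply/idealD/idealN. Qed.

Lemma ideal_sum (T : Type) (r : seq T) (P : pred T) F :
  (forall i, P i -> I (F i)) -> I (\sum_(i <- r | P i) F i).
Proof. by move=> IF; elim/big_ind: _ => //; [exact: ideal0|exact: idealD]. Qed.

End Ideals.

Lemma idealZ (k : fieldType) n (I : ideal {mpoly k[n]}) (c : k) u : I u -> I (c *: u).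
Proof. by rewrite -mul_mpolyC; apply: idealMl. Qed.

(** All terms of [g] have degree [d], so only the constant term of [r] contributes up to degree
    [d]. *)
Lemma mcoeffM_low (k : fieldType) n d (r g : {mpoly k[n]}) m :
  g \is d.-homog -> (mdeg m <= d)%N -> (r * g)@_m = r@_0%MM * g@_m.
Proof.
move=> hg md; rewrite mcoeffM.
have h0 : (mdeg (0%MM : 'X_{1..n}) < (mdeg m).+1)%N by rewrite mdeg0.
rewrite (bigD1 (BMultinom h0, BMultinom (ltnSn (mdeg m)))) /= ?add0m //.
rewrite big1 ?addr0 // => -[k1 k2] /= /andP[/eqP E ne].
have [h|h] := eqVneq (mdeg k2) d; last by rewrite (dhomog_nemf_coeff hg h) mulr0.
case/negP: ne; move: (congr1 (@mdeg n) E); rewrite mdegD => /= E'.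
have z1 : k1 = 0%MM :> 'X_{1..n} by apply/eqP; rewrite -mdeg_eq0; lia.
rewrite z1 add0m in E.
by apply/eqP; congr (_, _); apply: val_inj => /=.
Qed.

Lemma msym_homog (k : fieldType) n d (s : 'S_n) (u : {mpoly k[n]}) :
  u \is d.-homog -> msym s u \is d.-homog.
Proof.
move=> hu; apply/dhomogP => m; rewrite mcoeff_msupp mcoeff_sym => h.
have /= <- := dhomog_mf hu (x := m#s); first by rewrite mdeg_mperm.
by rewrite mcoeff_msupp.
Qed.

Lemma sym_ideal_msym (k : fieldType) n (f : {mpoly k[n]}) s :
  sym_ideal f (msym s f).
Proof.
exists (fun s' => (s' == s)%:R); rewrite (bigD1 s) //= eqxx mul1r.
by rewrite big1 ?addr0 // => s' /negPf ->; rewrite mul0r.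
Qed.

Lemma mem_sym_ideal (k : fieldType) n (f : {mpoly k[n]}) : sym_ideal f f.
Proof. by have := sym_ideal_msym f 1%g; rewrite msym1m. Qed.

(** * Degrees above [d], and a linear description of the ideal *)

Section SymmetricIdealStructure.
Variables (k : fieldType) (n d : nat) (f : {mpoly k[n]}).
Hypotheses (d_ge2 : (2 <= d)%N) (n_large : (d.+1 < n)%N).
Local Notation I := (sym_ideal f).
Local Notation N i := 'C((n + i).-1, i).

Let n_gt0 : (0 < n)%N. Proof. exact: leq_ltn_trans n_large. Qed.

Hypothesis f_homog : f \is d.-homog.
Hypothesis sum_f : \sum_l (vec d f *m typemx k n d) 0 l != 0.
Hypothesis kerI : forall w : 'rV_(N d), w *m typemx k n d = 0 -> I (pol w).

Let eqI (m m' : 'X_{1..n}) := I ('X_[m] - 'X_[m']).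

Let eqI_refl m : eqI m m.
Proof. by rewrite /eqI subrr; apply: ideal0. Qed.
Let eqI_sym m m' : eqI m m' -> eqI m' m.
Proof. by rewrite /eqI => h; rewrite -opprB; apply: idealN. Qed.
Let eqI_trans m' m m'' : eqI m m' -> eqI m' m'' -> eqI m m''.
Proof. by move=> h h'; have := idealD h h'; rewrite addrA subrK. Qed.

Lemma sym_ideal_perm m (s : 'S_n) : mdeg m = d -> I ('X_[m] - 'X_[m#s]).
Proof.
move=> md; have ms : mdeg (m#s) = d by rewrite mdeg_mperm.
rewrite -[X in I X](@vecK k n n_gt0 d); last first.
  by rewrite rpredB // dhomogX /= ?md ?ms.
by apply: kerI; rewrite linearB mulmxBl !vec_X_typemx // mtype_perm subrr.
Qed.

Let eqI_shift e (s : 'S_n) i : mdeg e = d -> eqI (e + U_(i))%MM (e#s + U_(i))%MM.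
Proof.
move=> md; rewrite /eqI !mpolyXD -mulrBl mulrC.
exact/idealMl/sym_ideal_perm.
Qed.

(** Set one factor ['X_i] aside: the transposition fixes it and acts on the remaining monomial of
    degree [d], where [sym_ideal_perm] applies. *)
Let eqI_tperm m (p q i : 'I_n) : mdeg m = d.+1 -> i != p -> i != q -> m i != 0%N ->
  eqI m (m#(tperm p q)).
Proof.
move=> md ip iq mi; have le : (U_(i) <= m)%MM by rewrite lep1mP.
have := @eqI_shift (m - U_(i))%MM (tperm p q) i.
rewrite submK //.
have -> : ((m - U_(i))%MM#(tperm p q) + U_(i) = m#(tperm p q))%MM.
  apply/mnmP => j; rewrite !(mnmDE, mnmBE, mnmE).
  case: tpermP => [->|->|_ _].
  - by rewrite (negPf ip) (negPf iq) subn0 addn0.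
  - by rewrite (negPf ip) (negPf iq) subn0 addn0.
  - by case: (i =P j) mi => [->|_] /=; lia.
apply; have := congr1 (@mdeg n) (submK le); rewrite mdegD mdeg1 md; lia.
Qed.

Let supp (m : 'X_{1..n}) := [set i | m i != 0%N].

Let card_supp m : (#|supp m| <= mdeg m)%N.
Proof.
rewrite mdegE -sum1_card [leqRHS](bigID (mem (supp m))) /=.
by rewrite (leq_trans _ (leq_addr _ _)) // leq_sum // => i; rewrite inE lt0n.
Qed.

Let squarefree (m : 'X_{1..n}) := forall i, (m i <= 1)%N.

Let eqI_squarefree m : mdeg m = d.+1 ->
  exists m', [/\ mdeg m' = d.+1, squarefree m' & eqI m m'].
Proof.
have [b] := ubnP (d.+1 - #|supp m|); elim: b m => // b IH m hb md.
have [/forallP sf|] := boolP [forall i, (m i <= 1)%N]; first by exists m.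
rewrite negb_forall => /existsP[i]; rewrite -ltnNge => mi.
have [j /negPf mj] : exists j, j \notin supp m.
  apply/existsP; rewrite -negb_forall; apply/negP => /forallP full.
  have : (#|[set: 'I_n]| <= #|supp m|)%N.
    by apply: subset_leq_card; apply/subsetP => x _; apply: full.
  by rewrite cardsT card_ord; have := card_supp m; lia.
move: mj; rewrite inE => /negbFE/eqP mj.
have ij : i != j by apply: contraTneq mi => ->; rewrite mj.
have le : (U_(i) <= m)%MM by rewrite lep1mP; lia.
have de : mdeg (m - U_(i))%MM = d.
  by have := congr1 (@mdeg n) (submK le); rewrite mdegD mdeg1 md; lia.
pose m' := ((m - U_(i))%MM#(tperm i j) + U_(i))%MM.
have m'E x : m' x = (if x == i then 1 else if x == j then (m i).-1 else m x)%N.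
  rewrite !(mnmDE, mnmBE, mnmE); have [->|xi] := eqVneq x i.
    by rewrite tpermL ?(negPf ij) mj ?eqxx.
  have [->|xj] := eqVneq x j; first by rewrite tpermR ?eqxx ?(negPf ij) ?addn0 subn1.
  by rewrite tpermD 1?eq_sym // ?(negPf xi) subn0 addn0.
have md' : mdeg m' = d.+1 by rewrite mdegD mdeg1 mdeg_mperm de addn1.
have mm' : eqI m m' by have := eqI_shift (tperm i j) i de; rewrite submK.
have [|//|m'' [md'' sf h]] := IH m'; last first.
  by exists m''; split=> //; apply: eqI_trans h.
have := card_supp m'; have -> : supp m' = j |: supp m.
  apply/setP => x; rewrite !inE m'E; have [->|xi] := eqVneq x i; first by lia.
  by have [_|_] := eqVneq x j; rewrite ?orTb ?orFb //; lia.
have -> : #|j |: supp m| = #|supp m|.+1 by rewrite cardsU1 inE mj.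
by rewrite md' => hs; lia.
Qed.

Let squarefree_perm_eq (m : 'X_{1..n}) : squarefree m ->
  perm_eq m (nseq (mdeg m) 1%N ++ nseq (n - mdeg m) 0%N).
Proof.
move=> sf; rewrite -sumn_mdeg -[n in (n - _)%N](size_tuple m).
have : all (fun x => x <= 1)%N m.
  apply/allP => x /(nthP 0%N)[j]; rewrite size_tuple => hj <-.
  by rewrite -(mnm_nth _ _ (Ordinal hj)).
elim: (tval m) => //= x r IH /andP[hx /IH h].
have hr : (sumn r <= size r)%N.
  by rewrite (perm_size h) size_cat !size_nseq leq_addr.
case: x hx => [|[|]] //= _; last by rewrite subSS perm_cons.
rewrite add0n subSn //= perm_sym -[0%N :: nseq _ _]cat1s perm_catCA /= perm_cons.
by rewrite perm_sym.
Qed.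

(** A square-free monomial of degree [d.+1] involves at least three variables since [2 <= d], so
    every transposition fixes one of them and [eqI_tperm] applies. *)
Let eqI_perm (m : 'X_{1..n}) (s : 'S_n) : mdeg m = d.+1 -> squarefree m -> eqI m (m#s).
Proof.
move=> md sf; have [ts -> _] := prod_tpermP s.
elim: ts m md sf => [|[p q] ts IH] m md sf; first by rewrite big_nil mperm1.
rewrite big_cons mpermM /=.
have sft (m' : 'X_{1..n}) (s' : 'S_n) : squarefree m' -> squarefree (m'#s').
  by move=> h i; rewrite mnmE.
apply: eqI_trans (IH m md sf) _.
set m' := m#_.
have md' : mdeg m' = d.+1 by rewrite mdeg_mperm.
have sf' : squarefree m' by apply: sft.
have c3 : #|supp m'| = d.+1.
  rewrite -md' mdegE -sum1_card big_mkcond; apply: eq_bigr => i _.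
  by rewrite inE; have := sf' i; case: (m' i) => [|[|]].
have [i] : exists i, i \in supp m' :\: [set p; q].
  apply/set0Pn; rewrite -card_gt0 cardsD c3.
  have : (#|supp m' :&: [set p; q]| <= 2)%N.
    by apply: leq_trans (subset_leq_card (subsetIr _ _)) _; rewrite cards2; case: eqP.
  by lia.
rewrite !inE negb_or => /andP[/andP[ip iq] mi].
exact: eqI_tperm md' ip iq mi.
Qed.

Let eqI_all m m' : mdeg m = d.+1 -> mdeg m' = d.+1 -> eqI m m'.
Proof.
move=> /eqI_squarefree[m1 [d1 sf1 e1]] /eqI_squarefree[m2 [d2 sf2 e2]].
have [|s sE] := @perm_eq_mnm n m1 m2.
  apply: perm_trans (squarefree_perm_eq sf1) _; rewrite perm_sym d1 -d2.
  exact: squarefree_perm_eq.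
apply: eqI_trans e1 _; apply: eqI_trans (eqI_sym e2).
by rewrite sE; apply: eqI_perm.
Qed.

(** All monomials of degree [d.+1] are congruent modulo [I], so ['X_j * f] is congruent to the
    coefficient sum [S] times any of them, and [S] is invertible. Higher degrees follow by
    multiplication. *)
Lemma sym_ideal_X_high m : (d < mdeg m)%N -> I 'X_[m].
Proof.
move=> hm; have [e E] : exists e, mdeg m = (d.+1 + e)%N by exists (mdeg m - d.+1)%N; lia.
elim: e m E {hm} => [|e IH] m md; last first.
  have [i [m' -> md']] := mnm_split (etrans md (addnS _ _)).
  by rewrite mpolyXD mulrC; apply/idealMl/IH.
rewrite addn0 in md.
pose j := Ordinal n_gt0; pose S := \sum_t (vec d f) 0 t.
have S0 : S != 0 by rewrite /S -sum_mul_typemx.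
have If := idealMl 'X_j (mem_sym_ideal f).
have Id : I ('X_j * f - S *: 'X_[m]).
  rewrite -[f in 'X_j * f](vecK n_gt0 f_homog) mulr_sumr scaler_suml -sumrB.
  apply: ideal_sum => t _; rewrite -scalerAr -scalerBr -mpolyXD.
  by apply/idealZ/eqI_all => //; rewrite mdegD mdeg1 mdeg_mon.
have := idealZ S^-1 (idealB If Id).
by rewrite opprB addrC subrK scalerA mulVf // scale1r.
Qed.

(** The degree [d] part of an element of the ideal is a combination of permuted copies of [f] with
    constant coefficients, and all copies have the same type sums. Later sections start from this
    description as [idealP]. *)
Lemma sym_idealP u : I u <->
  (forall m, (mdeg m < d)%N -> u@_m = 0) /\
  (exists c, vec d u *m typemx k n d = c *: (vec d f *m typemx k n d)).
Proof.
have f_sym s := msym_homog s f_homog.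
split=> [[r ->]|[low [c cE]]].
  split=> [m md|].
    rewrite raddf_sum big1 //= => s _; rewrite (mcoeffM_low _ (f_sym s) (ltnW md)).
    by rewrite (dhomog_nemf_coeff (f_sym s)) ?mulr0 // neq_ltn md.
  exists (\sum_s (r s)@_0%MM); rewrite linear_sum mulmx_suml scaler_suml.
  apply: eq_bigr => s _; rewrite -(vec_msym_typemx n_gt0 d s) scalemxAl.
  congr (_ *m _); apply/rowP => t.
  by rewrite !mxE (mcoeffM_low _ (f_sym s)) // mdeg_mon.
have high v : (forall m, (mdeg m <= d)%N -> v@_m = 0) -> I v.
  move=> hv; rewrite (mpolyE v) big_seq; apply: ideal_sum => m.
  rewrite mcoeff_msupp => vm; apply/idealZ/sym_ideal_X_high.
  by rewrite ltnNge; apply: contraNN vm => /hv ->.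
(* A part above degree [d], an element of the kernel of the type sums, and a multiple of [f]. *)
have -> : u = (u - pol (vec d u)) + pol (vec d u - c *: vec d f) + c *: f.
  by rewrite linearB linearZ /= (vecK n_gt0 f_homog) -addrA subrK subrK.
apply: idealD; last exact/idealZ/(mem_sym_ideal f).
apply: idealD; last by apply: kerI; rewrite mulmxBl cE -scalemxAl subrr.
apply: high => m; rewrite leq_eqVlt => /orP[/eqP md|md].
  by have [t /eqP <-] := mon_ex n_gt0 md; rewrite mcoeffB mcoeff_pol // mxE subrr.
rewrite mcoeffB low // (dhomog_nemf_coeff (pol_homog n_gt0 _)) ?subrr //.
by rewrite neq_ltn md.
Qed.

End SymmetricIdealStructure.

(** * Genericity *)

Section OrbitSpan.
Variables (k : fieldType) (n : nat) (f : {mpoly k[n]}).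

Definition orbit_span (u : {mpoly k[n]}) :=
  exists a : 'S_n -> k, u = \sum_s a s *: msym s f.

Lemma orbit_span0 : orbit_span 0.
Proof. by exists (fun=> 0); rewrite big1 // => s _; rewrite scale0r. Qed.

Lemma orbit_spanD u v : orbit_span u -> orbit_span v -> orbit_span (u + v).
Proof.
move=> [a ->] [b ->]; exists (fun s => a s + b s); rewrite -big_split.
by apply: eq_bigr => s _; rewrite scalerDl.
Qed.

Lemma orbit_spanZ c u : orbit_span u -> orbit_span (c *: u).
Proof.
move=> [a ->]; exists (fun s => c * a s); rewrite scaler_sumr.
by apply: eq_bigr => s _; rewrite scalerA.
Qed.

Lemma orbit_span_msym s : orbit_span (msym s f).
Proof.
exists (fun s' => (s' == s)%:R); rewrite (bigD1 s) //= eqxx scale1r.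
by rewrite big1 ?addr0 // => s' /negPf ->; rewrite scale0r.
Qed.

Lemma msym_orbit_span s u : orbit_span u -> orbit_span (msym s u).
Proof.
move=> [a ->]; rewrite raddf_sum /=; elim/big_ind: _ => //; first exact: orbit_span0.
  exact: orbit_spanD.
move=> t _; rewrite msymZ; apply: orbit_spanZ.
by rewrite -msymMm; apply: orbit_span_msym.
Qed.

End OrbitSpan.

(** * An explicit form whose orbit spans the kernel of the type sums *)

Section Witness.
Variables (k : fieldType) (n d : nat).
Hypothesis n_large : (npartitions d * d < n)%N.
Variable alpha : 'I_(npartitions d) -> k.
Hypothesis alpha_neq0 : forall l, alpha l != 0.

Definition witness : {mpoly k[n]} := \sum_l alpha l *: 'X_[mrep n l].

Let d_lt_n : (d < n)%N.
Proof.
by apply: leq_ltn_trans n_large; rewrite leq_pmull // npartitions_gt0.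
Qed.

Let V := orbit_span witness.
Let eqV (m m' : 'X_{1..n}) := V ('X_[m] - 'X_[m']).

Let eqV_trans m' m m'' : eqV m m' -> eqV m' m'' -> eqV m m''.
Proof. by move=> h h'; have := orbit_spanD h h'; rewrite addrA subrK. Qed.

Let eqV_refl m : eqV m m.
Proof. by rewrite /eqV subrr; apply: orbit_span0. Qed.

(** As [n_large] is strict, there is a variable of index [npartitions d * d], and no representative
    involves it. *)
Let mrep_hole (l : 'I_(npartitions d)) (q : 'I_n) : q = (npartitions d * d)%N :> nat -> mrep n l q = 0%N.
Proof.
move=> qE; apply/eqP/negPn/negP => /mrep_supp/andP[_].
by rewrite qE -mulSnr ltnNge leq_mul2r ltn_ord orbT.
Qed.

(** Every term of [witness] except the one of type [l] involves neither [p] nor [q], so subtracting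
    the transposed form isolates [alpha l] times the difference. *)
Let eqV_mrep (l : 'I_(npartitions d)) (p q : 'I_n) : mrep n l p != 0%N -> q = (npartitions d * d)%N :> nat ->
  eqV (mrep n l) (mrep n l # tperm p q).
Proof.
move=> lp qE; have tau0 l' : l' != l -> mrep n l' # tperm p q = mrep n l'.
  move=> ne; have lp0 : mrep n l' p = 0%N.
    by apply/eqP/negPn/negP => h; case/eqP: ne; apply: mrep_supp_disj h lp.
  by apply/mnmP => i; rewrite mnmE; case: tpermP => // ->; rewrite lp0 mrep_hole.
have : V (witness - msym (tperm p q) witness).
  rewrite -[X in V (X - _)]msym1m -scaleN1r.
  by apply: orbit_spanD; [|apply: orbit_spanZ]; apply: orbit_span_msym.
rewrite {1 2}/witness [msym _ _]raddf_sum /= -sumrB (bigD1 l) //= big1 => [|l' ne]; last first.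
  by rewrite msymZ msymX tpermV tau0 ?subrr.
rewrite addr0 msymZ msymX tpermV -scalerBr => /(orbit_spanZ (alpha l)^-1).
by rewrite scalerA mulVf // scale1r.
Qed.

(** Move [m] to its representative by a permutation [w] that sends [q] to the hole [q0], apply
    [eqV_mrep] there, and move back: the span is stable under permutations. *)
Let eqV_hole m (p q : 'I_n) : mdeg m = d -> m p != 0%N -> m q = 0%N ->
  eqV m (m # tperm p q).
Proof.
move=> md mp mq; set l := mtype d m.
have [s sE] : exists s : 'S_n, m = mrep n l # s.
  by apply: mtype_orbit (ltnW d_lt_n) _ md _; rewrite ?mdeg_mrep ?mtype_mrep // ltnW.
pose q0 := Ordinal n_large; pose w := (s * tperm (s q) q0)%g.
have sq0 : mrep n l (s q) = 0%N.
  by have := congr1 (fun m' : 'X_{1..n} => m' q) sE; rewrite /= mq mnmE => <-.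
have q00 : mrep n l q0 = 0%N by apply: mrep_hole.
have wE : m = mrep n l # w.
  rewrite [LHS]sE; apply/mnmP => i; rewrite [LHS]mnmE [RHS]mnmE permM.
  by case: tpermP => // ->; rewrite sq0 q00.
have wq : w q = q0 by rewrite permM tpermL.
have lp : mrep n l (w p) != 0%N by move: mp; rewrite {1}wE mnmE.
have := msym_orbit_span w^-1%g (eqV_mrep lp (erefl (q0 : nat))).
rewrite raddfB /= !msymX invgK -wE /eqV.
suff -> : (mrep n l # tperm (w p) q0) # w = m # tperm p q by [].
apply/mnmP => i; rewrite [LHS]mnmE [LHS]mnmE [RHS]mnmE [in RHS]wE [RHS]mnmE -wq.
by rewrite (inj_tperm p q i (@perm_inj _ w)).
Qed.

Let eqV_tperm m (p q : 'I_n) : mdeg m = d -> eqV m (m # tperm p q).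
Proof.
move=> md; have [pq|pq] := eqVneq (m p) (m q).
  suff -> : m # tperm p q = m by apply: eqV_refl.
  by apply/mnmP => i; rewrite mnmE; case: tpermP => // ->.
have [mq|mq] := eqVneq (m q) 0%N; first by apply: eqV_hole => //; rewrite -mq.
have [mp|mp] := eqVneq (m p) 0%N; first by rewrite tpermC; apply: eqV_hole.
have {}pq : p != q by apply: contraNneq pq => ->.
have [r mr] : exists r, m r = 0%N.
  have /existsP[r] : [exists r, m r == 0%N]; last by move/eqP; exists r.
  rewrite -[X in is_true X]negbK negb_exists; apply/negP => /forallP full.
  have : (\sum_(i < n) 1 <= mdeg m)%N.
    by rewrite mdegE; apply: leq_sum => i _; rewrite lt0n.
  by rewrite sum1_card card_ord md leqNgt d_lt_n.
have rp : r != p by apply: contraNneq mp => <-; rewrite mr.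
have rq : r != q by apply: contraNneq mq => <-; rewrite mr.
have [pr qr qp] : [/\ p != r, q != r & q != p] by split; rewrite eq_sym.
pose m1 := m # tperm p r; pose m2 := m1 # tperm p q; pose m3 := m2 # tperm q r.
have -> : m # tperm p q = m3.
  apply/mnmP => i; rewrite !mnmE.
  have [->|ip] := eqVneq i p; first by rewrite tpermL (tpermD qp rp) tpermL tpermD.
  have [->|iq] := eqVneq i q; first by rewrite tpermR tpermL (tpermD pr qr) tpermR.
  have [->|ir] := eqVneq i r; first by rewrite tpermR tpermR tpermL tpermD.
  by rewrite !(@tpermD _ _ _ i) // eq_sym.
have d1 : mdeg m1 = d by rewrite mdeg_mperm.
have d2 : mdeg m2 = d by rewrite mdeg_mperm.
apply: (@eqV_trans m1); first exact: eqV_hole.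
apply: (@eqV_trans m2).
  by rewrite /m2 tpermC; apply: eqV_hole => //; rewrite mnmE ?tpermL // tpermD.
rewrite /m3 tpermC; apply: eqV_hole => //.
  by rewrite !mnmE (tpermD pr qr) tpermR.
by rewrite !mnmE tpermR tpermL.
Qed.

Lemma witness_perm m (s : 'S_n) : mdeg m = d -> orbit_span witness ('X_[m] - 'X_[m # s]).
Proof.
move=> md; have [ts -> _] := prod_tpermP s.
elim: ts => [|[p q] ts IH]; first by rewrite big_nil mperm1; apply: eqV_refl.
rewrite big_cons mpermM /=; apply: eqV_trans IH _.
by apply: eqV_tperm; rewrite mdeg_mperm.
Qed.

Lemma witness_homog : witness \is d.-homog.
Proof.
apply: rpred_sum => l _; rewrite rpredZ // dhomogX /= mdeg_mrep //.
exact: ltnW.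
Qed.

Lemma vec_witness_typemx : vec d witness *m typemx k n d = \row_l alpha l.
Proof.
have n0 : (0 < n)%N by apply: leq_ltn_trans n_large.
rewrite linear_sum mulmx_suml; apply/rowP => l; rewrite summxE mxE.
rewrite (bigD1 l) //= big1 => [|l' ne]; rewrite linearZ -scalemxAl vec_X_typemx //=.
- by rewrite mtype_mrep ?(ltnW n_large) // !mxE !eqxx mulr1 addr0.
- by rewrite mdeg_mrep // ltnW.
- by rewrite mtype_mrep ?(ltnW n_large) // !mxE eqxx eq_sym (negPf ne) mulr0.
- by rewrite mdeg_mrep // ltnW.
Qed.

End Witness.

Lemma dhomog_prod_seq (R : comNzRingType) n (T : Type) (r : seq T)
    (e : T -> nat) (F : T -> {mpoly R[n]}) :
  (forall i, F i \is (e i).-homog) ->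
  \prod_(i <- r) F i \is (\sum_(i <- r) e i)%N.-homog.
Proof.
move=> hF; elim: r => [|i r IH]; first by rewrite !big_nil dhomog1.
by rewrite !big_cons; apply: dhomogM.
Qed.

Lemma det_homog (R : comNzRingType) n N (B : 'M[{mpoly R[n]}]_N) (e : 'I_N -> nat) :
  (forall i j, B i j \is (e i).-homog) -> \det B \is (\sum_i e i)%N.-homog.
Proof.
move=> hB; apply: rpred_sum => s _; rewrite rpredMsign.
exact: dhomog_prod_seq.
Qed.

(** * The conditions on a general form as nonvanishing of one polynomial *)

Section Generic.
Variables (k : fieldType) (n d : nat).
Hypothesis n_large : (npartitions d * d < n)%N.
Local Notation N := 'C((n + d).-1, d).
Local Notation P := (npartitions d).

Let n_gt0 : (0 < n)%N. Proof. exact: leq_ltn_trans n_large. Qed.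

Definition kernel_in_ideal (f : {mpoly k[n]}) :=
  forall w : 'rV[k]_N, w *m typemx k n d = 0 -> sym_ideal f (pol w).

Definition coef_form (m : 'X_{1..n}) : {mpoly k[N]} :=
  \sum_(t < N) (mon t == m)%:R *: 'X_t.

Lemma coef_form_homog m : coef_form m \is 1.-homog.
Proof. by apply: rpred_sum => t _; rewrite rpredZ // dhomogX /= mdeg1. Qed.

Lemma meval_coef_form m c : (coef_form m).@[c] = (general_form c)@_m.
Proof.
rewrite /coef_form /general_form !raddf_sum; apply: eq_bigr => t _ /=.
by rewrite mevalZ mevalXU mcoeffZ mcoeffX mulrC.
Qed.

Definition is_rep (t : 'I_N) := mon t == mrep n (mtype d (mon t)).

Lemma is_repP t (l : 'I_P) : mon t = mrep n l -> is_rep t.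
Proof. by move=> E; rewrite /is_rep E mtype_mrep // ltnW. Qed.

(* The rows indexed by non-representatives express the elements
   [sum_s a t s *: msym s (general_form c)] of the orbit span. *)
Definition span_matrix (a : 'I_N -> 'S_n -> k) : 'M[{mpoly k[N]}]_N :=
  \matrix_(t, t') if is_rep t then (t == t')%:R
                  else \sum_s a t s *: coef_form (mon t' # s).

Lemma det_span_matrix_homog a : exists e : nat, \det (span_matrix a) \is e.-homog.
Proof.
exists (\sum_t if is_rep t then 0 else 1)%N; apply: det_homog => t t'.
rewrite mxE; case: ifP => _; first by case: eqP; rewrite ?dhomog1 ?dhomog0.
by apply: rpred_sum => s _; rewrite rpredZ // coef_form_homog.
Qed.

Lemma meval_span_matrix a c :
  map_mx (meval c) (span_matrix a) =
  \matrix_t if is_rep t then delta_mx 0 t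
            else vec d (\sum_s a t s *: msym s (general_form c)).
Proof.
apply/matrixP => t t'; rewrite !mxE; case: ifP => _.
  by rewrite mxE eqxx /= eq_sym; case: eqP => _; rewrite ?meval1 ?meval0.
rewrite !mxE !raddf_sum; apply: eq_bigr => s _ /=.
by rewrite mevalZ meval_coef_form mcoeffZ mcoeff_sym.
Qed.

(** Write [w] as a combination [y] of the rows of the invertible matrix. Rows of nonrepresentatives
    have zero type sums, and representatives have distinct types, so [y] vanishes on
    representatives. Hence [w] comes from the orbit of the form. *)
Lemma kernel_in_idealP a c : (forall t, ~~ is_rep t -> \sum_s a t s = 0) ->
  (\det (span_matrix a)).@[c] != 0 -> kernel_in_ideal (general_form c).
Proof.
move=> a0 detB w wS; set f := general_form c.
pose B := map_mx (meval c) (span_matrix a).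
have uB : B \in unitmx by rewrite unitmxE det_map_mx unitfE.
have := mulmxKV uB w; move: (w *m invmx B) => y yB.
have rowB t : row t B = if is_rep t then delta_mx 0 t
            else vec d (\sum_s a t s *: msym s f).
  by rewrite /B meval_span_matrix rowK.
have nonrep t : ~~ is_rep t -> row t B *m typemx k n d = 0.
  move=> nt; rewrite rowB (negPf nt) linear_sum mulmx_suml.
  under eq_bigr do rewrite linearZ -scalemxAl (vec_msym_typemx n_gt0).
  by rewrite -scaler_suml a0 // scale0r.
have y0 t : is_rep t -> y 0 t = 0.
  move=> rt; have /= := congr1 (fun v : 'rV_P => v 0 (mtype d (mon t))) wS.
  rewrite -yB (mulmx_sum_row y B) mulmx_suml summxE mxE => E; rewrite -[RHS]E.
  rewrite (bigD1 t) //= -scalemxAl rowB rt -rowE !mxE eqxx mulr1.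
  rewrite big1 ?addr0 // => t' ne; rewrite -scalemxAl mxE.
  have [rt'|nt'] := boolP (is_rep t'); last by rewrite nonrep // mxE mulr0.
  rewrite rowB rt' -rowE !mxE; case: eqP => [E'|]; rewrite ?mulr0 //.
  by case/eqP: ne; apply: (mon_inj n_gt0); rewrite (eqP rt) (eqP rt') E'.
suff mem (J : ideal {mpoly k[n]}) : (forall s, J (msym s f)) -> J (pol w).
  exact/mem/sym_ideal_msym.
move=> Jf; rewrite -yB (mulmx_sum_row y B) linear_sum; apply: ideal_sum => t _.
rewrite linearZ /=; have [rt|nt] := boolP (is_rep t).
  by rewrite y0 // scale0r; apply: ideal0.
apply: idealZ; rewrite rowB (negPf nt) vecK //.
  by apply: ideal_sum => s _; apply/idealZ/Jf.
by apply: rpred_sum => s _; rewrite rpredZ // msym_homog // /f general_formE pol_homog.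
Qed.

(** At such a [c] the matrix is the identity minus a matrix of square zero, whose nonzero entries
    lie in nonrepresentative rows and representative columns. *)
Lemma det_span_matrix_neq0 a c :
  (forall t, ~~ is_rep t -> \sum_s a t s *: msym s (general_form c) =
     'X_[mon t] - 'X_[mrep n (mtype d (mon t))]) ->
  (\det (span_matrix a)).@[c] != 0.
Proof.
move=> aE; rewrite -det_map_mx -unitfE -unitmxE -row_free_unit.
apply: inj_row_free => y yB.
have BE t t' : (map_mx (meval c) (span_matrix a)) t t' = (t == t')%:R -
    (if is_rep t then 0 else (mrep n (mtype d (mon t)) == mon t')%:R).
  rewrite meval_span_matrix mxE; case: ifP => [_|/negbT nt].
    by rewrite mxE eqxx eq_sym subr0.
  by rewrite aE // mxE mcoeffB !mcoeffX (inj_eq (@mon_inj n n_gt0 d)).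
have yE t' : y 0 t' = \sum_(t | ~~ is_rep t) y 0 t * (mrep n (mtype d (mon t)) == mon t')%:R.
  have := congr1 (fun v : 'rV_N => v 0 t') yB; rewrite !mxE.
  under eq_bigr do rewrite BE mulrBr; rewrite sumrB => /eqP; rewrite subr_eq0 => /eqP E.
  transitivity (\sum_t y 0 t * (t == t')%:R).
    rewrite (bigD1 t') //= eqxx mulr1 big1 ?addr0 // => t ne.
    by rewrite (negPf ne) mulr0.
  rewrite E [RHS]big_mkcond; apply: eq_bigr => t _.
  by case: ifP; rewrite ?mulr0.
have y0 t : ~~ is_rep t -> y 0 t = 0.
  move=> nt; rewrite yE big1 // => t' _; case: eqP => [E|]; last by rewrite mulr0.
  by case/negP: nt; apply: is_repP (esym E).
apply/rowP => t; rewrite mxE yE big1 // => t' /y0 ->; exact: mul0r.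
Qed.

Lemma exists_coefs (gamma : 'rV[k]_P) : (forall s : seq k, exists x : k, x \notin s) ->
  gamma != 0 -> exists alpha : 'I_P -> k,
  [/\ forall l, alpha l != 0, \sum_l alpha l != 0 & \sum_l alpha l * gamma 0 l != 0].
Proof.
move=> inf /rV0Pn[l0 g0].
(* All coefficients are 1 except [x] at [l0], where [gamma] is nonzero; each of the three conditions
   excludes one value of [x]. *)
have [x] := inf [:: 0; - \sum_(l < P | l != l0) 1;
                  - (\sum_(l < P | l != l0) gamma 0 l) / gamma 0 l0].
rewrite !inE !negb_or => /and3P[x0 x1 x2].
exists (fun l => if l == l0 then x else 1); split.
- by move=> l; case: ifP => // _; apply: oner_neq0.
- rewrite (bigD1 l0) //= eqxx; under eq_bigr => l /negPf -> do [].
  by rewrite addr_eq0.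
- rewrite (bigD1 l0) //= eqxx; under eq_bigr => l /negPf -> do rewrite mul1r.
  by rewrite addr_eq0; apply: contra x2 => /eqP <-; rewrite mulfK.
Qed.

(** The polynomial is a product of a determinant and two linear forms, one factor for each
    condition, and [witness] is a point where none of them vanishes. *)
Lemma generic_conditions (gamma : 'rV[k]_P) :
  (forall s : seq k, exists x : k, x \notin s) -> gamma != 0 ->
  exists p : {mpoly k[N]}, [/\ exists e : nat, p \is e.-homog,
    exists2 c, proj_point c & p.@[c] != 0 &
    forall c, p.@[c] != 0 ->
      let sf := vec d (general_form c) *m typemx k n d in
      [/\ kernel_in_ideal (general_form c), \sum_l sf 0 l != 0
        & \sum_l sf 0 l * gamma 0 l != 0]].
Proof.
move=> inf g0; have [alpha [al0 sal sag]] := exists_coefs inf g0.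
pose f0 := witness n alpha.
pose c0 (t : 'I_N) := vec d f0 0 t.
have f0E : general_form c0 = f0.
  rewrite general_formE -[RHS](vecK n_gt0 (witness_homog n_large alpha)).
  by congr pol; apply/rowP => t; rewrite mxE.
have sf0 : vec d (general_form c0) *m typemx k n d = \row_l alpha l.
  by rewrite f0E vec_witness_typemx.
(* The coefficients are found for the witness and then kept fixed while [c] varies. A finite
   function makes [xchoose] applicable. *)
have ex (t : 'I_N) : exists b : {ffun 'S_n -> k}, 'X_[mon t] - 'X_[mrep n (mtype d (mon t))] ==
    \sum_s b s *: msym s (general_form c0).
  have [||||s ->] := @mtype_orbit n d (mon t) (mrep n (mtype d (mon t))).
  - apply: ltnW; apply: leq_ltn_trans n_large; rewrite leq_pmull //.
    exact: npartitions_gt0.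
  - exact: (mdeg_mon n_gt0).
  - by rewrite mdeg_mrep // ltnW.
  - by rewrite mtype_mrep // ltnW.
  have [b bE] := witness_perm n_large al0 s (mdeg_mon n_gt0 t).
  exists (finfun b); rewrite bE f0E; apply/eqP/eq_bigr => s' _.
  by rewrite ffunE.
pose a t : 'S_n -> k := xchoose (ex t).
have aE t : \sum_s a t s *: msym s (general_form c0) =
    'X_[mon t] - 'X_[mrep n (mtype d (mon t))].
  exact/esym/eqP/(xchooseP (ex t)).
have l0 : 'I_P := Ordinal (npartitions_gt0 d).
(* The difference on the right has zero type sums, while all permuted witnesses have type sums
   [alpha], which is nonzero at [l0]. *)
have a0 t : \sum_s a t s = 0.
  have := congr1 (fun u => (vec d u *m typemx k n d) 0 l0) (aE t).
  rewrite linearB mulmxBl !vec_X_typemx ?mdeg_mon ?mdeg_mrep ?(ltnW n_large) //.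
  rewrite mtype_mrep ?(ltnW n_large) // subrr linear_sum mulmx_suml.
  under eq_bigr do rewrite linearZ -scalemxAl (vec_msym_typemx n_gt0).
  rewrite -scaler_suml sf0 !mxE => /eqP; rewrite mulf_eq0 (negPf (al0 l0)) orbF.
  by move/eqP.
pose lin (h : 'I_N -> k) : {mpoly k[N]} := \sum_t h t *: 'X_t.
have lin_homog h : lin h \is 1.-homog.
  by apply: rpred_sum => t _; rewrite rpredZ // dhomogX /= mdeg1.
have linE h c : (lin h).@[c] = \sum_t h t * c t.
  by rewrite raddf_sum; apply: eq_bigr => t _ /=; rewrite mevalZ mevalXU.
have vecE (c : 'I_N -> k) t : vec d (general_form c) 0 t = c t.
  by rewrite general_formE (polK n_gt0) mxE.
have sumE (c : 'I_N -> k) : (lin (fun=> 1)).@[c] =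
    \sum_l (vec d (general_form c) *m typemx k n d) 0 l.
  by rewrite linE sum_mul_typemx; apply: eq_bigr => t _; rewrite mul1r vecE.
have gammaE (c : 'I_N -> k) : (lin (fun t => gamma 0 (mtype d (mon t)))).@[c] =
    \sum_l (vec d (general_form c) *m typemx k n d) 0 l * gamma 0 l.
  rewrite linE (partition_big (fun t => mtype d (mon t)) predT) //=.
  apply: eq_bigr => l _; rewrite mul_typemxE mulr_suml; apply: eq_bigr => t /eqP <-.
  by rewrite vecE mulrC.
exists (\det (span_matrix a) * lin (fun=> 1) *
        lin (fun t => gamma 0 (mtype d (mon t)))); split.
- have [e he] := det_span_matrix_homog a.
  by exists (e + 1 + 1)%N; apply: dhomogM => //; apply: dhomogM.
- exists c0.
    apply/existsP; apply: contraNT sal; rewrite negb_exists => /forallP c00.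
    have := sum_mul_typemx (vec d (general_form c0)).
    rewrite sf0; under eq_bigr do rewrite mxE.
    move=> ->; rewrite big1 // => t _; rewrite vecE.
    by apply/eqP; rewrite -[_ == _]negbK.
  rewrite !mevalM !mulf_neq0 ?det_span_matrix_neq0 // ?sumE ?gammaE sf0.
    by under eq_bigr do rewrite mxE.
  by under eq_bigr do rewrite mxE.
- move=> c; rewrite !mevalM !mulf_eq0 !negb_or sumE gammaE => /andP[/andP[h1 h2] h3].
  by split=> //; apply: kernel_in_idealP h1 => t _.
Qed.

End Generic.

(** * Linear algebra on types *)

Section Multiplication.
Variables (k : fieldType) (n e : nat).
Hypotheses (n_gt0 : (0 < n)%N) (e_le_n : (e < n)%N).
Hypothesis large : (npartitions e * e <= n)%N.
Local Notation R := {mpoly k[n]}.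
Local Notation N i := 'C((n + i).-1, i).

Definition mulXmx (j : 'I_n) : 'M[k]_(N e, N e.+1) :=
  \matrix_(t, t') (mon t' == (mon t + U_(j))%MM)%:R.

Lemma mulX_pol j (v : 'rV[k]_(N e)) : 'X_j * pol v = pol (v *m mulXmx j).
Proof.
rewrite mulmx_sum_row linear_sum mulr_sumr; apply: eq_bigr => t _.
rewrite -scalerAr linearZ -mpolyXD; congr (_ *: _).
have dt : mdeg (mon t + U_(j))%MM = e.+1 by rewrite mdegD mdeg1 mdeg_mon // addn1.
rewrite addmC -[LHS](@vecK k n n_gt0 e.+1) ?dhomogX /= ?dt //; congr pol.
by apply/rowP => t'; rewrite !mxE mcoeffX eq_sym.
Qed.

Lemma mulXmx_typemxE j t l :
  (mulXmx j *m typemx k n e.+1) t l = (mtype e.+1 (mon t + U_(j))%MM == l)%:R.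
Proof.
have dt : mdeg (mon t + U_(j))%MM = e.+1 by rewrite mdegD mdeg1 mdeg_mon // addn1.
have [t0 /eqP t0E] := mon_ex n_gt0 dt.
rewrite mxE (bigD1 t0) //= !mxE -t0E eqxx mul1r big1 ?addr0 // => t' ne.
by rewrite !mxE -t0E (inj_eq (@mon_inj n n_gt0 _)) (negPf ne) mul0r.
Qed.

(* The matrix of multiplication by the sum of the variables on the
   coinvariants of degree [e]. *)
Definition coinvmx : 'M[k]_(npartitions e, npartitions e.+1) :=
  \matrix_(l, l') \sum_j (mtype e.+1 (mrep n l + U_(j))%MM == l')%:R.

Lemma mnmU_perm (s : 'S_n) (m : 'X_{1..n}) j :
  (m # s + U_(j))%MM = (m + U_(s j))%MM # s.
Proof. by apply/mnmP => i; rewrite !(mnmE, mnmDE) (inj_eq perm_inj). Qed.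

(** The sum of the variables is symmetric, so multiplication by it descends to type sums. *)
Lemma sum_mulXmx_typemx :
  (\sum_j mulXmx j) *m typemx k n e.+1 = typemx k n e *m coinvmx.
Proof.
apply/matrixP => t l; rewrite mulmx_suml summxE.
under eq_bigr do rewrite mulXmx_typemxE.
rewrite mxE (bigD1 (mtype e (mon t))) //= mxE eqxx mul1r [X in _ + X]big1 ?addr0; last first.
  by move=> l' ne; rewrite mxE eq_sym (negPf ne) mul0r.
have [||||s sE] := @mtype_orbit n e (mrep n (mtype e (mon t))) (mon t).
- exact: ltnW.
- exact: mdeg_mrep.
- exact: mdeg_mon.
- exact: mtype_mrep.
under eq_bigr do rewrite sE mnmU_perm mtype_perm.
by rewrite mxE [RHS](reindex_inj (@perm_inj _ s)).
Qed.

Hypothesis char0 : [pchar k] =i pred0.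

Lemma sum_msym_symmetric (u : R) : \sum_(s : 'S_n) msym s u \is symmetric.
Proof.
apply/issymP => s; rewrite raddf_sum /= [RHS](reindex_inj (mulIg s)).
by apply: eq_bigr => s' _; rewrite msymMm.
Qed.

(** For a symmetric [u] a type sum is a coefficient times the size of an orbit, which is nonzero in
    characteristic 0. *)
Lemma symmetric_vec_typemx_eq0 i (u : R) : (i <= n)%N -> u \is symmetric ->
  u \is i.-homog -> vec i u *m typemx k n i = 0 -> u = 0.
Proof.
move=> i_le_n /issymP usym hu uS; rewrite -(vecK n_gt0 hu).
suff -> : vec i u = 0 by rewrite linear0.
apply/rowP => t; rewrite [RHS]mxE.
have := congr1 (fun v : 'rV_(npartitions i) => v 0 (mtype i (mon t))) uS.
rewrite /= mul_typemxE [RHS]mxE (eq_bigr (fun=> vec i u 0 t)) => [|t' /eqP ty]; last first.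
  have [||s sE] := mtype_orbit i_le_n _ _ ty; rewrite ?mdeg_mon // !mxE.
  by rewrite sE -[LHS]/(u@_(mon t')) -{1}(usym s) mcoeff_sym.
rewrite sumr_const => /eqP; rewrite -mulr_natr mulf_eq0 => /orP[/eqP//|].
have /pcharf0P -> := char0; rewrite -leqn0 leqNgt => /negP[].
by apply/card_gt0P; exists t; apply: eqxx.
Qed.

(** Lift [v] to a combination of representatives and symmetrize it to [u], with type sums [n!] times
    [v]. If [v] is killed, the symmetric product of [u] and [\sum_j 'X_j] has zero type sums, hence
    vanishes, and [u = 0] because polynomials form a domain. *)
Lemma coinvmx_row_free : row_free coinvmx.
Proof.
apply: inj_row_free => v vT.
pose u0 : R := \sum_l v 0 l *: 'X_[mrep n l].
have u0_homog : u0 \is e.-homog.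
  by apply: rpred_sum => l _; rewrite rpredZ // dhomogX /= mdeg_mrep.
have u0S : vec e u0 *m typemx k n e = v.
  rewrite linear_sum mulmx_suml [RHS]row_sum_delta; apply: eq_bigr => l _.
  by rewrite linearZ -scalemxAl vec_X_typemx ?mdeg_mrep // mtype_mrep.
pose u := \sum_(s : 'S_n) msym s u0.
have u_homog : u \is e.-homog by apply: rpred_sum => s _; apply: msym_homog.
have uS : vec e u *m typemx k n e = #|'S_n|%:R *: v.
  rewrite linear_sum mulmx_suml; under eq_bigr do rewrite vec_msym_typemx // u0S.
  by rewrite sumr_const scaler_nat.
pose x : R := \sum_j 'X_j.
have xu : x * u = pol (vec e u *m \sum_j mulXmx j).
  rewrite -{1}(vecK n_gt0 u_homog) mulr_suml mulmx_sumr [RHS]linear_sum.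
  by apply: eq_bigr => j _; rewrite mulX_pol.
have : x * u = 0.
  apply: (@symmetric_vec_typemx_eq0 e.+1) => //.
  - rewrite rpredM ?sum_msym_symmetric //; apply/issymP => s.
    rewrite raddf_sum /= [RHS](reindex_inj (@perm_inj _ s)).
    apply: eq_bigr => j _; rewrite msymX; congr 'X_[_]; apply/mnmP => i.
    by rewrite !mnmE (can2_eq (permK s) (permKV s)).
  - by rewrite xu pol_homog.
  - by rewrite xu polK // -mulmxA sum_mulXmx_typemx mulmxA uS -scalemxAl vT scaler0.
move/eqP; rewrite mulf_eq0 => /orP[/eqP x0|/eqP u0'].
  have := congr1 (fun p : R => p@_(U_(Ordinal n_gt0))) x0.
  rewrite /x raddf_sum mcoeff0 (bigD1 (Ordinal n_gt0)) //= mcoeffXU eqxx big1.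
    by rewrite addr0 => /eqP; rewrite oner_eq0.
  by move=> j ne; rewrite mcoeffXU (negPf ne).
move: uS; rewrite u0' linear0 mul0mx => /esym/eqP; rewrite scaler_eq0 => /orP[|/eqP//].
by have /pcharf0P -> := char0;
  rewrite -leqn0 leqNgt => /negP[]; apply/card_gt0P; exists 1%g.
Qed.

(** [coinvmx^T] is contraction by the sum of the variables on symmetric elements, so [gamma] is a
    symmetric element that this contraction kills. *)
Lemma coinvmx_ker : (npartitions e < npartitions e.+1)%N ->
  exists2 gamma : 'rV[k]_(npartitions e.+1), gamma != 0 & gamma *m coinvmx^T = 0.
Proof.
move=> lt; have /rowV0Pn[g /sub_kermxP gT g0] : kermx coinvmx^T != 0.
  by rewrite kermx_eq0 /row_free mxrank_tr (eqnP coinvmx_row_free) neq_ltn lt.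
by exists g.
Qed.

End Multiplication.

Lemma perm_two_points (T : finType) (p q i j : T) : p != q -> i != j ->
  exists s : {perm T}, s p = i /\ s q = j.
Proof.
move=> pq ij; exists (tperm p i * tperm (tperm p i q) j)%g; rewrite !permM tpermL.
split; last by rewrite tpermL.
rewrite tpermD //; last by rewrite eq_sym.
by rewrite -[X in _ != X](tpermL p i) (inj_eq perm_inj) eq_sym.
Qed.

(** * Contraction in coordinates *)

Section Contraction.
Variables (k : fieldType) (n : nat).
Implicit Types u g : {mpoly k[n]}.

Lemma sum_msupp_eq g x : \sum_(m <- msupp g) g@_m * (m == x)%:R = g@_x.
Proof.
rewrite {3}(mpolyE g) raddf_sum; apply: eq_bigr => m _ /=.
by rewrite mcoeffZ mcoeffX.
Qed.

Lemma mcoeff_contract u g e :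
  (contract u g)@_e = \sum_(m <- msupp u) u@_m * g@_(m + e).
Proof.
rewrite /contract raddf_sum; apply: eq_bigr => m _ /=.
rewrite raddf_sum big_mkcond -[g@_(m + e)]sum_msupp_eq mulr_sumr.
apply: eq_bigr => e' _ /=; rewrite mcoeffZ mcoeffX.
have [le|nle] := boolP (m <= e')%MM.
  rewrite -mulrA; congr (_ * (_ * _%:R)).
  by rewrite -[in RHS](submK le) [in RHS]addmC eqm_add2l.
case: eqP => [E|_]; last by rewrite !mulr0.
by case/negP: nle; rewrite E lem_addr.
Qed.

Lemma sum_msupp_enum (T : finType) (h : T -> 'X_{1..n}) u (F : 'X_{1..n} -> k) :
  injective h -> (forall m, u@_m != 0 -> F m != 0 -> exists t, m = h t) ->
  \sum_(m <- msupp u) u@_m * F m = \sum_t u@_(h t) * F (h t).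
Proof.
move=> h_inj hu; under [RHS]eq_bigr do rewrite -sum_msupp_eq mulr_suml.
rewrite exchange_big /= big_seq [RHS]big_seq; apply: eq_bigr => m.
rewrite mcoeff_msupp => um.
have [F0|F0] := eqVneq (F m) 0.
  rewrite F0 mulr0 big1 // => t _; case: eqP => [<-|]; rewrite ?F0 ?mulr0 //.
  by rewrite mul0r.
have [t0 E] := hu m um F0; rewrite (bigD1 t0) //= -E eqxx mulr1 big1 ?addr0 //.
by move=> t ne; rewrite E (inj_eq h_inj) eq_sym (negPf ne) mulr0 mul0r.
Qed.

Lemma mcoeff_contract1 u g e : u \is 1.-homog ->
  (contract u g)@_e = \sum_j u@_(U_(j)) * g@_(U_(j) + e).
Proof.
move=> hu; rewrite mcoeff_contract.
apply: (@sum_msupp_enum _ _ u (fun m => g@_(m + e))).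
  by move=> i j /eqP; rewrite eq_mnm1 => /eqP.
move=> m um _; have [/mdeg1P[j /eqP ->]|ne] := boolP (mdeg m == 1%N); first by exists j.
by case/eqP: um; apply: dhomog_nemf_coeff hu ne.
Qed.

End Contraction.

(** * The inverse system in degree [d] and its linear syzygies *)

Section Narrow.
Variables (k : fieldType) (n e : nat).
Hypotheses (e_gt0 : (0 < e)%N) (n_gt1 : (1 < n)%N).
Local Notation d := e.+1.
Local Notation P := (npartitions d).
Hypothesis large : (P * d <= n)%N.
Hypothesis char0 : [pchar k] =i pred0.
Local Notation R := {mpoly k[n]}.
Local Notation N i := 'C((n + i).-1, i).
Local Notation S := (typemx k n d).

Let n_gt0 : (0 < n)%N. Proof. exact: ltnW. Qed.
Let P_lt : (npartitions e < P)%N.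
Proof. by have := @npartitions_pred_lt d; rewrite subn1; apply. Qed.
Let d_le_n : (d <= n)%N.
Proof. by apply: leq_trans large; rewrite leq_pmull // npartitions_gt0. Qed.
Let large' : (npartitions e * e <= n)%N.
Proof. by apply: leq_trans large; rewrite leq_mul // ltnW. Qed.

(** Replacing the variables of a monomial one at a time by ['X_i0] leads from any type to that of
    the power ['X_i0 ^+ d]. *)
Lemma move_const (H : 'I_P -> k) :
  (forall i j (m : 'X_{1..n}), mdeg m = e -> H (mtype d (m + U_(i))%MM) = H (mtype d (m + U_(j))%MM)) ->
  forall l l', H l = H l'.
Proof.
move=> hH; pose i0 := Ordinal n_gt0.
have key r m : (mdeg m + mdeg r)%N = d ->
    H (mtype d (m + r)%MM) = H (mtype d (m + U_(i0) *+ mdeg r)%MM).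
  have [b rb] : exists b, mdeg r = b by exists (mdeg r).
  elim: b r m rb => [|b IH] r m rb E.
    by move/eqP: rb; rewrite mdeg_eq0 => /eqP ->; rewrite mdeg0 mulm0n.
  rewrite rb; have [j [r' rE r'b]] := mnm_split rb.
  rewrite rE [(r' + _)%MM]addmC addmA IH // ?mdegD ?mdeg1; last by lia.
  rewrite r'b mulmS [(U_(i0) + _)%MM]addmC addmA -addmA [(U_(j) + _)%MM]addmC addmA.
  by apply: hH; rewrite mdegD mdegMn mdeg1; lia.
move=> l l'; have dl := mdeg_mrep large.
have one x : H x = H (mtype d (0 + U_(i0) *+ d)%MM).
  by rewrite -{1}(mtype_mrep large x) -{1}[mrep n x]add0m key dl // mdeg0.
by rewrite one [RHS]one.
Qed.

Variable sf : 'rV[k]_P.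
Hypothesis sum_sf : \sum_l sf 0 l != 0.

(** Row [j] of [G] stands for [G_j]. When the relations at [m] and at [m # tperm p q] are compared,
    all terms other than those of [p] and [q] cancel, which makes [H] invariant under replacing a
    factor ['X_p] by ['X_q]. *)
Lemma syzygy_const (G : 'M[k]_(n, P)) : G *m sf^T = 0 ->
  (forall m, mdeg m = e -> \sum_j G j (mtype d (m + U_(j))%MM) = 0) ->
  forall p q, row p G = row q G.
Proof.
move=> Gsf hG p q; have [->//|pq] := eqVneq p q.
pose H l := G p l - G q l.
have H1 m : mdeg m = e -> H (mtype d (m + U_(p))%MM) = H (mtype d (m + U_(q))%MM).
  move=> md; have E1 := hG m md.
  have := hG (m # tperm p q); rewrite mdeg_mperm => /(_ md).
  under eq_bigr do rewrite mnmU_perm mtype_perm.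
  move=> E2; have := etrans E2 (esym E1); rewrite (bigD1 p) //= (bigD1 q) 1?eq_sym //= [RHS](bigD1 p) //=.
  rewrite [X in _ = _ + X](bigD1 q) 1?eq_sym //= tpermL tpermR.
  rewrite (eq_bigr (fun i => G i (mtype d (m + U_(i))%MM))); last first.
    by move=> i /andP[ip iq]; rewrite tpermD // eq_sym.
  rewrite !addrA => /addIr E; rewrite /H; apply/eqP.
  rewrite -subr_eq0 opprB addrACA -opprD subr_eq0 -E addrC.
  by apply/eqP; rewrite addrC.
have H2 l l' : H l = H l'.
  (* A permutation carries [p], [q] to any other pair [i], [j] without changing types. *)
  apply: move_const => i j m md; have [->//|ij] := eqVneq i j.
  have [w [<- <-]] := perm_two_points pq ij.
  have ty x : mtype d (m + U_(w x))%MM = mtype d (m # w + U_(x))%MM.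
    by rewrite mnmU_perm mtype_perm.
  by rewrite !ty; apply: H1; rewrite mdeg_mperm.
apply/rowP => l; rewrite !mxE; apply/eqP; rewrite -subr_eq0 -/(H l).
have : (row p G - row q G) *m sf^T = 0 by rewrite mulmxBl -!row_mul Gsf !row0 subrr.
move/(congr1 (fun v : 'M_1 => v 0 0)); rewrite !mxE.
rewrite (eq_bigr (fun l' => H l * sf 0 l')) => [/eqP|l' _]; last first.
  by rewrite !mxE -/(H l') (H2 l' l).
by rewrite -mulr_sumr mulf_eq0 (negPf sum_sf) orbF.
Qed.

(* [locked] prevents [rewrite] from unfolding [row_base] to a product. *)
Definition hypmx : 'M[k]_(\rank (kermx sf^T), P) :=
  locked (row_base (kermx sf^T)).
Local Notation a := (\rank (kermx sf^T)).

Let sf_neq0 : sf != 0.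
Proof.
by apply: contraNneq sum_sf => ->; rewrite big1 // => l _; rewrite mxE.
Qed.

Lemma rank_hyp : a = P.-1.
Proof. by rewrite mxrank_ker mxrank_tr rank_rV sf_neq0 subn1. Qed.

Lemma hypmx_free : row_free hypmx. Proof. by rewrite /hypmx -lock row_base_free. Qed.

Lemma sub_hypmx m (A : 'M_(m, P)) : (A <= hypmx)%MS = (A *m sf^T == 0).
Proof. by rewrite /hypmx -lock eq_row_base; apply/sub_kermxP/eqP. Qed.

Lemma hypmx_sf : hypmx *m sf^T = 0.
Proof. by apply/eqP; rewrite -sub_hypmx. Qed.

Let sf_hypmx : sf *m hypmx^T = 0.
Proof. by apply: trmx_inj; rewrite trmx_mul trmxK hypmx_sf trmx0. Qed.

(** The kernel of [hypmx^T] contains [sf] and has dimension 1, as [hypmx] has rank [P.-1]. *)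
Lemma mul_hypmx_trP (x : 'rV_P) : x *m hypmx^T = 0 <-> exists c, x = c *: sf.
Proof.
split=> [/sub_kermxP xk|[c ->]]; last first.
  by rewrite -scalemxAl sf_hypmx scaler0.
apply/sub_rVP; apply: submx_trans xk _.
have sk : (sf <= kermx hypmx^T)%MS.
  exact/sub_kermxP.
rewrite -(mxrank_leqif_sup sk) rank_rV sf_neq0 mxrank_ker mxrank_tr.
by rewrite (eqnP hypmx_free) rank_hyp; have := npartitions_gt0 d; lia.
Qed.

Lemma typemx_tr_free i : (i <= n)%N -> (npartitions i * i <= n)%N -> row_free (typemx k n i)^T.
Proof.
move=> i_le_n hi; apply: inj_row_free => v vS; apply/rowP => l.
have [t /eqP tE] := mon_ex n_gt0 (mdeg_mrep hi l).
have := congr1 (fun w : 'rV_(N i) => w 0 t) vS.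
by rewrite /= mul_typemx_trE tE mtype_mrep // !mxE.
Qed.

Let St_free : row_free S^T. Proof. exact: typemx_tr_free. Qed.

Variable I : ideal R.
Hypothesis idealP : forall u, I u <->
  (forall m, (mdeg m < d)%N -> u@_m = 0) /\ (exists c, vec d u *m S = c *: sf).

Lemma ideal_homogP u : u \is d.-homog -> I u <-> vec d u *m (S *m hypmx^T) = 0.
Proof.
move=> hu; rewrite mulmxA mul_hypmx_trP; split=> [/idealP[]//|h].
apply/idealP; split=> // m md; apply: dhomog_nemf_coeff hu _.
by rewrite neq_ltn md.
Qed.

Definition perp_basis (i : 'I_a) : R := pol (row i (hypmx *m S^T)).

Lemma perp_basisE i (t : 'I_(N d)) : (perp_basis i)@_(mon t) = hypmx i (mtype d (mon t)).
Proof.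
by rewrite /perp_basis mcoeff_pol // row_mul mul_typemx_trE mxE.
Qed.

(** [u] has no term below degree [d] and [g] none outside it, so contraction leaves only the pairing
    of their degree [d] coefficients. *)
Lemma contract_homog u g e' : I u -> g \is d.-homog ->
  (contract u g)@_e' = if e' == 0%MM then (vec d u *m (vec d g)^T) 0 0 else 0.
Proof.
move=> /idealP[low _] hg; rewrite mcoeff_contract.
have [->|ne] := eqVneq e' 0%MM.
  rewrite (@sum_msupp_enum _ _ _ (@mon n d) _ (fun m => g@_(m + 0))).
  - by rewrite mxE; apply: eq_bigr => t _; rewrite !mxE addm0.
  - exact: mon_inj.
  - move=> m um; rewrite addm0 => gm.
    have /(mon_ex n_gt0)[t /eqP <-] : mdeg m = d; last by exists t.
    by apply/eqP; apply: contraNT gm => ne; rewrite (dhomog_nemf_coeff hg).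
rewrite big1 // => m _; have [/low ->|dm] := ltnP (mdeg m) d; first by rewrite mul0r.
rewrite (dhomog_nemf_coeff hg) ?mulr0 //= mdegD.
by move: ne; rewrite -mdeg_eq0; lia.
Qed.

Lemma perp_basisP : is_basis (perp_comp I d) perp_basis.
Proof.
have polE (c : 'I_a -> k) :
    \sum_i c i *: perp_basis i = pol ((\row_i c i) *m hypmx *m S^T).
  rewrite -mulmxA mulmx_sum_row linear_sum; apply: eq_bigr => i _.
  by rewrite linearZ mxE.
split.
- move=> i; split; last exact: pol_homog.
  move=> u Iu; apply/mpolyP => e'; rewrite mcoeff0 contract_homog ?pol_homog //.
  case: eqP => // _; have [_ [c cE]] := (idealP u).1 Iu.
  rewrite polK // row_mul trmx_mul trmxK mulmxA cE -scalemxAl.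
  have -> : sf *m (row i hypmx)^T = 0.
    by apply: trmx_inj; rewrite trmx_mul trmxK -row_mul hypmx_sf row0 trmx0.
  by rewrite scaler0 mxE.
- move=> c; rewrite polE => /(congr1 (@vec k n d)); rewrite polK // linear0 => E i.
  have := row_free_inj St_free; move/(_ _ _ 0) => inj1.
  have {E} /inj1 E : (\row_i c i) *m hypmx *m S^T = 0 *m S^T by rewrite E mul0mx.
  have := row_free_inj hypmx_free; move/(_ _ _ 0) => inj2.
  have /inj2/rowP/(_ i) : (\row_i c i) *m hypmx = 0 *m hypmx by rewrite E mul0mx.
  by rewrite !mxE.
- move=> g [gI hg]; pose w := vec d g.
  have pair u : I u -> (vec d u *m w^T) 0 0 = 0.
    move=> Iu; have := contract_homog 0%MM Iu hg; rewrite eqxx => <-.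
    by rewrite gI // mcoeff0.
  have rep (l : 'I_P) : exists t : 'I_(N d), mon t == mrep n l.
    by apply: mon_ex => //; apply: mdeg_mrep.
  pose tl l := xchoose (rep l); have tlE l : mon (tl l) = mrep n l.
    exact/eqP/(xchooseP (rep l)).
  pose gam := \row_l w 0 (tl l).
  (* [g] kills differences of monomials of the same type, so its coefficients depend only on the
     type. *)
  have wE : w = gam *m S^T.
    apply/rowP => t; rewrite mul_typemx_trE mxE; set l := mtype d (mon t).
    have Iu : I ('X_[mon t] - 'X_[mon (tl l)]).
      apply/ideal_homogP; first by rewrite rpredB // dhomogX /= mdeg_mon.
      rewrite mulmxA linearB mulmxBl !vec_X_typemx ?mdeg_mon //.
      by rewrite tlE mtype_mrep // subrr mul0mx.
    have vecX t' : vec d 'X_[mon t'] = delta_mx 0 t' :> 'rV[k]_(N d).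
      apply/rowP => t''; rewrite !mxE mcoeffX eqxx /= (inj_eq (@mon_inj n n_gt0 d)).
      by rewrite eq_sym.
    have := pair _ Iu; rewrite linearB /= !vecX mulmxBl -!rowE !mxE => /eqP.
    by rewrite subr_eq0 => /eqP.
  have gam_sf : (gam <= hypmx)%MS.
    (* Pair [g] with the form supported on the representatives whose type sums are [sf]. *)
    have If : I (pol (\sum_l sf 0 l *: delta_mx 0 (tl l))).
      apply/idealP; split.
        move=> m md; rewrite (dhomog_nemf_coeff (pol_homog n_gt0 _)) //.
        by rewrite neq_ltn md.
      exists 1; rewrite polK // scale1r mulmx_suml [RHS]row_sum_delta.
      apply: eq_bigr => l _; rewrite -scalemxAl -rowE; congr (_ *: _).
      by apply/rowP => l'; rewrite !mxE tlE mtype_mrep // eqxx eq_sym.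
    rewrite sub_hypmx; apply/eqP/matrixP => x y; rewrite !ord1 [RHS]mxE.
    rewrite -(pair _ If) polK // mulmx_suml summxE mxE; apply: eq_bigr => l _.
    by rewrite -scalemxAl -rowE !mxE mulrC.
  have [c cE] := submxP gam_sf; exists (fun i => c 0 i).
  rewrite polE -(vecK n_gt0 hg) -/w wE cE; congr (pol (_ *m _ *m _)).
  by apply/rowP => i; rewrite mxE.
Qed.

(** With [y] the matrix of coefficients of the [l i], the hypothesis is a linear syzygy of the rows
    of [y *m hypmx]. By [syzygy_const] these rows agree, and so do those of [y] since [hypmx] is
    free: each [l i] has all its coefficients equal. *)
Lemma perp_basis_narrow (l : 'I_a -> R) : (forall i, l i \is 1.-homog) ->
  \sum_i contract (l i) (perp_basis i) = 0 ->
  exists c : 'I_a -> k, forall i, l i = c i *: \sum_j 'X_j.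
Proof.
move=> hl lF; pose y : 'M[k]_(n, a) := \matrix_(j, i) (l i)@_(U_(j)).
have yE : forall p q, row p (y *m hypmx) = row q (y *m hypmx).
  apply: syzygy_const; first by rewrite -mulmxA hypmx_sf mulmx0.
  move=> m md; have := congr1 (mcoeff m) lF; rewrite raddf_sum mcoeff0 => E.
  rewrite -[RHS]E.
  under [RHS]eq_bigr => i _ do rewrite /= mcoeff_contract1 //.
  rewrite [RHS]exchange_big; apply: eq_bigr => j _; rewrite mxE; apply: eq_bigr => i _.
  have [t /eqP tE] : exists t : 'I_(N d), mon t == (m + U_(j))%MM.
    by apply: mon_ex => //; rewrite mdegD mdeg1 md addn1.
  by rewrite mxE [(U_(j) + _)%MM]addmC -tE perp_basisE.
pose j0 := Ordinal n_gt0; exists (fun i => y j0 i) => i.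
have yj j : y j i = y j0 i.
  have := yE j j0; rewrite !row_mul => /(row_free_inj hypmx_free)/rowP/(_ i).
  by rewrite !mxE.
apply/mpolyP => m; rewrite mcoeffZ raddf_sum /=.
have [/mdeg1P[j /eqP ->]|ne] := boolP (mdeg m == 1%N); last first.
  rewrite (dhomog_nemf_coeff (hl i)) // big1 ?mulr0 // => j _.
  by rewrite mcoeffX; case: eqP => // E; rewrite -E mdeg1 in ne.
rewrite (bigD1 j) //= mcoeffXU eqxx big1 ?addr0 ?mulr1 => [|j' ne].
  by rewrite -(yj j) mxE.
by rewrite mcoeffXU (negPf ne).
Qed.

(** Row [i] is the contraction of [perp_basis i] by ['X_j], so the rows of the stacked matrix
    [syz_colmx] span the contractions of [(I^perp)_{-d}] by linear forms. *)
Definition syzmx j : 'M[k]_(a, N e) := (mulXmx k e j *m (S *m hypmx^T))^T.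
Definition syz_colmx := \mxcol_(j < n) syzmx j.

Variable gamma : 'rV[k]_P.
Hypotheses (gammaT : gamma *m (coinvmx k n e)^T = 0)
  (gamma_sf : \sum_l sf 0 l * gamma 0 l != 0).

Lemma rank_sum_syzmx : \rank (\sum_j syzmx j)%R = npartitions e.
Proof.
have -> : \sum_j syzmx j = hypmx *m (coinvmx k n e)^T *m (typemx k n e)^T.
  rewrite /syzmx -linear_sum /= -mulmx_suml mulmxA sum_mulXmx_typemx //.
  by rewrite trmx_mul trmxK trmx_mul mulmxA.
rewrite mxrankMfree; last by apply: typemx_tr_free => //; apply: ltnW.
set T := (coinvmx k n e)^T.
have rT : \rank T = npartitions e.
  by rewrite mxrank_tr; apply/eqnP/coinvmx_row_free.
transitivity (\rank T); last exact: rT.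
apply/eqP; rewrite eqn_leq mxrankM_maxr mxrankS //.
pose b := (\sum_l sf 0 l * gamma 0 l)^-1.
(* The projection along [gamma] onto the hyperplane orthogonal to [sf]; since [T] kills [gamma],
   restricting to the hyperplane does not lower the rank. *)
pose A := 1%:M - b *: (sf^T *m gamma).
have AT : A *m T = T.
  by rewrite mulmxBl mul1mx -scalemxAl -mulmxA gammaT mulmx0 scaler0 subr0.
rewrite -{1}AT.
apply: submxMr; rewrite sub_hypmx mulmxBl mul1mx -scalemxAl -mulmxA.
have -> : gamma *m sf^T = (\sum_l sf 0 l * gamma 0 l)%:M.
  rewrite [LHS]mx11_scalar mxE; congr (_%:M).
  by apply: eq_bigr => l _; rewrite mxE mulrC.
by rewrite mul_mx_scalar scalerA mulVf // scale1r subrr.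
Qed.

(** The left kernel consists of the linear syzygies of [perp_basis], which by [syzygy_const] are
    diagonal: [c] repeated [n] times, with [c] in the kernel of the sum. It has dimension
    [a - npartitions e], and the matrix has [n * a] rows. *)
Lemma rank_syz_colmx : \rank syz_colmx = ((n - 1) * a + npartitions e)%N.
Proof.
pose E : 'M[k]_(a, \sum_(j < n) a) := \mxrow_j 1%:M.
have E_free : row_free E.
  pose j0 := Ordinal n_gt0; apply/row_freeP.
  exists (\mxcol_(j < n) ((j == j0)%:R%:M : 'M[k]_a)).
  rewrite mul_mxrow_mxcol (bigD1 j0) //= ?eqxx mul1mx big1 ?addr0 //.
  by move=> j /negPf ->; rewrite raddf0 mulmx0.
have kE : (kermx syz_colmx :=: kermx (\sum_j syzmx j)%R *m E)%MS.
  apply/eqmxP/andP; split; last first.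
    apply/sub_kermxP; rewrite -mulmxA mul_mxrow_mxcol.
    by rewrite -mulmx_sumr mul1mx mulmx_ker.
  apply/rV_subP => v /sub_kermxP vM.
  pose y : 'M_(n, a) := \matrix_j submxrow v j.
  have vE : v = \mxrow_j row j y.
    by rewrite -[LHS]submxrowK; apply: eq_mxrow => j; rewrite rowK.
  have {}vM : \sum_j row j y *m syzmx j = 0 by rewrite -[RHS]vM vE mul_mxrow_mxcol.
  have yE : forall p q, row p (y *m hypmx) = row q (y *m hypmx).
    apply: syzygy_const; first by rewrite -mulmxA hypmx_sf mulmx0.
    move=> m /(mon_ex n_gt0)[t /eqP <-].
    have := congr1 (fun w : 'rV_(N e) => w 0 t) vM; rewrite /= summxE [RHS]mxE => E0.
    rewrite -[RHS]E0.
    apply: eq_bigr => j _; rewrite /syzmx mulmxA trmx_mul trmxK mulmxA -row_mul.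
    rewrite [RHS]mxE (bigD1 (mtype d (mon t + U_(j))%MM)) //=.
    rewrite [_^T _ _]mxE mulXmx_typemxE // eqxx mulr1 big1 ?addr0 => [|l ne].
      by rewrite [RHS]mxE.
    by rewrite [_^T _ _]mxE mulXmx_typemxE // eq_sym (negPf ne) mulr0.
  pose c := row (Ordinal n_gt0) y.
  have yc j : row j y = c.
    by have := yE j (Ordinal n_gt0); rewrite !row_mul => /(row_free_inj hypmx_free).
  have -> : v = c *m E.
    by rewrite vE mul_mxrow; apply: eq_mxrow => j; rewrite mulmx1 yc.
  apply: submxMr; apply/sub_kermxP; rewrite mulmx_sumr -[RHS]vM.
  by apply: eq_bigr => j _; rewrite yc.
have := mxrank_ker syz_colmx; rewrite kE mxrankMfree // mxrank_ker rank_sum_syzmx.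
move: (rank_leq_row syz_colmx); move: (\rank syz_colmx) => r.
rewrite sum_nat_const card_ord.
have : (npartitions e <= a)%N by rewrite -rank_sum_syzmx rank_leq_row.
rewrite mulnBl mul1n; have : (a <= n * a)%N by rewrite leq_pmull.
by lia.
Qed.

(** Each [u * 'X_j] has degree [d], where membership in [I] is linear by [ideal_homogP]; the
    equations for all [j] are put side by side. This makes the socle in degree [e] a kernel. *)
Lemma socle_ideal_homogP u : u \is e.-homog ->
  (forall j, I (u * 'X_j)) <-> vec e u *m syz_colmx^T = 0.
Proof.
move=> hu.
have uX j : u * 'X_j = pol (vec e u *m mulXmx k e j).
  by rewrite mulrC -{1}(vecK n_gt0 hu) mulX_pol.
have Ij j : I (u * 'X_j) <-> vec e u *m (syzmx j)^T = 0.
  have := ideal_homogP (pol_homog n_gt0 (vec e u *m mulXmx k e j)).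
  by rewrite polK // -uX /syzmx trmxK !mulmxA.
rewrite /syz_colmx tr_mxcol mul_mxrow; split=> [h|].
  rewrite (eq_mxrow (B_ := fun j => 0)) => [|j]; last exact/Ij.
  by apply/matrixP => i j; rewrite !mxE.
move=> h j; apply/Ij; rewrite -[LHS](mxrowK (fun j => vec e u *m (syzmx j)^T)) h.
by rewrite submxrow0.
Qed.

End Narrow.

(** * The quotient algebra *)

Section Subspaces.
Variable k : fieldType.

(** [W] is an arbitrary predicate, so [K] is found classically: as long as some vector of [W] lies
    outside the row space, adding it raises the rank, which is at most [D]. *)
Lemma subspace_rowspace D (W : 'rV[k]_D -> Prop) :
  W 0 -> (forall a u v, W u -> W v -> W (a *: u + v)) ->
  exists K : 'M[k]_D, forall v, W v <-> (v <= K)%MS.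
Proof.
move=> W0 Wlin.
have grow b (K : 'M[k]_D) : (D - \rank K < b)%N -> (forall v, (v <= K)%MS -> W v) ->
    exists K' : 'M[k]_D, forall v, W v <-> (v <= K')%MS.
  elim: b K => // b IH K hb KW.
  case: (classic (forall v, W v -> (v <= K)%MS)) => [full|nfull].
    by exists K => v; split; [apply: full|apply: KW].
  have [v nv] := not_all_ex_not _ _ nfull; have [Wv /negP vK] := imply_to_and _ _ nv.
  have lt : (\rank K < \rank (K + v)%MS)%N.
    by apply: rank_ltmx; rewrite ltmxE addsmxSl addsmx_sub submx_refl.
  apply: (IH (K + v)%MS); first by have := rank_leq_row (K + v)%MS; lia.
  move=> w /sub_addsmxP[[a c] ->] /=.
  rewrite addrC (mx11_scalar c) mul_scalar_mx; apply: Wlin => //.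
  exact/KW/submxMl.
apply: (grow (D - \rank (0 : 'M[k]_D)).+1 0) => // v.
by rewrite submx0 => /eqP ->.
Qed.

Lemma subspace_chain_stable D (W : nat -> 'rV[k]_D -> Prop) :
  (forall m, W m 0) -> (forall m a u v, W m u -> W m v -> W m (a *: u + v)) ->
  (forall m v, W m.+1 v -> W m v) ->
  exists m0, forall m, (m0 <= m)%N -> forall v, W m v <-> W m0 v.
Proof.
move=> W0 Wlin Wdec.
have dec m m' v : (m <= m')%N -> W m' v -> W m v.
  by move=> /subnK <-; elim: (m' - m)%N => // i IH /Wdec.
have go r m (K : 'M[k]_D) : (forall v, W m v <-> (v <= K)%MS) -> (\rank K < r)%N ->
    exists m0, forall m', (m0 <= m')%N -> forall v, W m' v <-> W m0 v.
  elim: r m K => // r IH m K mK hr.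
  case: (classic (forall m', (m <= m')%N -> forall v, W m' v <-> W m v)) => [st|nst].
    by exists m.
  have [m1 nm1] := not_all_ex_not _ _ nst; have [mm1 nW] := imply_to_and _ _ nm1.
  have [v hv] := not_all_ex_not _ _ nW.
  have [K1 K1E] := subspace_rowspace (W0 m1) (Wlin m1).
  apply: (IH m1 K1 K1E); apply: leq_trans (hr : (\rank K <= r)%N).
  apply: rank_ltmx; rewrite ltmxE; apply/andP; split.
    by apply/rV_subP => w /K1E /(dec _ _ _ mm1)/mK.
  apply/negP => KK1; case: hv; split; first exact: dec.
  by move=> /mK vK; apply/K1E; apply: submx_trans KK1.
have [K KE] := subspace_rowspace (W0 0%N) (Wlin 0%N).
exact: (go _ _ _ KE (ltnSn _)).
Qed.

Lemma has_dim_rowspace (V : lmodType k) N p (phi : {linear 'rV[k]_N -> V})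
    (K : 'M[k]_(p, N)) (W : V -> Prop) :
  (forall v, (v <= K)%MS -> W (phi v)) ->
  (forall w, W w -> exists2 v, (v <= K)%MS & w = phi v) ->
  (forall v, (v <= K)%MS -> phi v = 0 -> v = 0) ->
  has_dim W (\rank K).
Proof.
move=> KW WK inj; pose B := row_base K; exists (fun i => phi (row i B)).
have sumE (c : 'I_(\rank K) -> k) :
    \sum_i c i *: phi (row i B) = phi ((\row_i c i) *m B).
  by rewrite mulmx_sum_row linear_sum; apply: eq_bigr => i _; rewrite linearZ mxE.
split.
- by move=> i; apply: KW; rewrite -(eq_row_base K) row_sub.
- move=> c; rewrite sumE => /inj h i.
  have /h h' : ((\row_i c i) *m B <= K)%MS by rewrite -(eq_row_base K) submxMl.
  have /(row_free_inj (row_base_free K))/rowP/(_ i) : (\row_i c i) *m B = 0 *m B.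
    by rewrite h' mul0mx.
  by rewrite !mxE.
- move=> w /WK[v]; rewrite -(eq_row_base K) => /submxP[c ->] ->.
  exists (fun i => c 0 i); rewrite sumE; congr (phi (_ *m _)).
  by apply/rowP => i; rewrite mxE.
Qed.

Lemma has_dim_zero (V : lmodType k) (W : V -> Prop) :
  W 0 -> (forall w, W w -> w = 0) -> has_dim W 0.
Proof.
move=> W0 Weq; have := @has_dim_rowspace V 0 0 (GRing.Linear.clone _ _ _ _ \0 _) 0 W.
rewrite mxrank0; apply=> // [w /Weq ->|v _ _]; first by exists 0; rewrite ?sub0mx.
by apply/rowP => -[].
Qed.

End Subspaces.

Section Quotient.
Variables (k : fieldType) (n : nat) (I : ideal {mpoly k[n]}).
Local Notation R := {mpoly k[n]}.
Local Notation A := (quot_ring I).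

Fact qpi_is_linear : linear (qpi I).
Proof. by move=> c u v; rewrite qpiD qpiZ. Qed.
HB.instance Definition _ :=
  GRing.isLinear.Build k R A _ (qpi I) qpi_is_linear.

Lemma qpi_eq0 u : qpi I u = 0 <-> I u.
Proof.
have <- : qpi I 0 = 0 by rewrite linear0.
by rewrite qpiP subr0.
Qed.

Lemma qpi_mul u v : qpi I (u * v) = qpi I u * qpi I v.
Proof. exact: qpiM. Qed.

Lemma quot_scaleE c (a : A) : c *: a = qpi I c%:MP * a.
Proof.
by rewrite -(qreprK a) -qpi_mul mul_mpolyC linearZ.
Qed.

Lemma in_socleP u : in_socle (qpi I u) <-> forall j, I (u * 'X_j).
Proof.
split=> [soc j|h b].
  apply/qpi_eq0; rewrite qpi_mul -[RHS](soc (fun i => qpi I (i == j)%:R)).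
  rewrite (bigD1 j) //= eqxx big1 ?addr0 => [|i /negPf ->].
    by rewrite -(qpi_mul 'X_j) mulr1.
  by rewrite -(qpi_mul 'X_i) mulr0 linear0.
rewrite mulr_sumr big1 // => j _; rewrite -(qreprK (b j)) -!qpi_mul.
by apply/qpi_eq0; rewrite mulrA mulrC; apply: idealMl.
Qed.

(** The quotient is spanned by the finitely many monomials of degree at most [i], and ideals are
    subspaces, so a chain of ideals pulls back to a chain of subspaces of a finite-dimensional
    space. *)
Lemma artinian_quot i : (forall m, (i < mdeg m)%N -> I 'X_[m]) -> artinian A.
Proof.
move=> high J Jdec.
pose T : finType := 'X_{1..n < i.+1}.
pose phi (v : 'rV[k]_#|T|) : A := \sum_t v 0 t *: qpi I 'X_[(enum_val t : T)].
have phi_lin : linear phi.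
  move=> c u v; rewrite /phi scaler_sumr -big_split; apply: eq_bigr => t _.
  by rewrite !mxE scalerDl scalerA.
have phi_surj a : exists v, a = phi v.
  pose u := qrepr a; exists (\row_t u@_((enum_val t : T))).
  rewrite -(qreprK a) -/u /phi; apply/eqP; rewrite -subr_eq0; apply/eqP.
  under eq_bigr do rewrite mxE -linearZ.
  rewrite -linear_sum -linearB; apply/qpi_eq0.
  set w := _ - _; rewrite (mpolyE w) big_seq; apply: ideal_sum => m.
  rewrite mcoeff_msupp => wm; apply/idealZ/high; rewrite ltnNge -ltnS.
  apply: contra wm => hm; rewrite /w mcoeffB raddf_sum /=.
  rewrite (bigD1 (enum_rank (BMultinom hm))) //= enum_rankK mcoeffZ mcoeffX eqxx mulr1.
  rewrite big1 ?addr0 ?subrr // => t ne; rewrite mcoeffZ mcoeffX.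
  case: eqP => [E|]; last by rewrite mulr0.
  case/eqP: ne; apply: enum_val_inj; rewrite enum_rankK.
  exact: val_inj.
have phi0 : phi 0 = 0.
  by rewrite /phi big1 // => t _; rewrite mxE scale0r.
have [||| m0 st] := @subspace_chain_stable k #|T| (fun m v => J m (phi v)).
- by move=> m; rewrite phi0; apply: ideal0.
- move=> m c u v Ju Jv; rewrite phi_lin; apply: idealD => //.
  by rewrite quot_scaleE; apply: idealMl.
- by move=> m v; apply: Jdec.
exists m0 => m hm a; have [v ->] := phi_surj a; exact: st.
Qed.

End Quotient.

(** Reconciles the integer coefficient with the dimension, a difference of natural numbers, through
    [(m - 1) * (p - 1) = (m - 1) * p - m + 1]. *)
Lemma socle_coefE (m p q C : nat) :
  (0 < m)%N -> (0 < p)%N -> ((m - 1) * p.-1 + q <= C)%N ->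
  C%:Z - (m%:Z - 1) * p%:Z - q%:Z + m%:Z - 1 = (C - ((m - 1) * p.-1 + q))%N%:Z.
Proof.
case: m p => [|m] [|p] // _ _; rewrite subn1 /= => le; rewrite -subzn //.
by rewrite PoszD PoszM !intS; ring.
Qed.

(** * Socle and narrowness of the quotient *)

Section Socle.
Variables (k : fieldType) (n e : nat).
Hypotheses (e_gt0 : (0 < e)%N) (n_gt1 : (1 < n)%N).
Local Notation d := e.+1.
Local Notation P := (npartitions d).
Hypothesis large : (P * d <= n)%N.
Local Notation R := {mpoly k[n]}.
Local Notation N i := 'C((n + i).-1, i).
Local Notation S := (typemx k n d).

Variable sf : 'rV[k]_P.
Hypothesis sum_sf : \sum_l sf 0 l != 0.
Variable I : ideal R.
Hypothesis idealP : forall u, I u <->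
  (forall m, (mdeg m < d)%N -> u@_m = 0) /\ (exists c, vec d u *m S = c *: sf).

Let n_gt0 : (0 < n)%N. Proof. exact: ltnW. Qed.
Let P_lt : (npartitions e < P)%N.
Proof. by have := @npartitions_pred_lt d; rewrite subn1; apply. Qed.
Let d_le_n : (d <= n)%N.
Proof. by apply: leq_trans large; rewrite leq_pmull // npartitions_gt0. Qed.

Lemma ideal_X_high m : (d < mdeg m)%N -> I 'X_[m].
Proof.
move=> hm; apply/idealP; split=> [m' hm'|].
  by rewrite mcoeffX; case: eqP hm hm' => // ->; lia.
exists 0; rewrite scale0r; suff -> : vec d 'X_[k, m] = 0 :> 'rV_(N d) by rewrite mul0mx.
apply/rowP => t; rewrite !mxE mcoeffX; case: eqP hm => // ->.
by rewrite mdeg_mon // ltnn.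
Qed.

Lemma ideal_high i u : (d < i)%N -> u \is i.-homog -> I u.
Proof.
move=> hi hu; rewrite (mpolyE u) big_seq; apply: ideal_sum => m um.
by apply/idealZ/ideal_X_high; rewrite -(dhomog_mf hu um) in hi.
Qed.

Lemma ideal_low i u : (i < d)%N -> u \is i.-homog -> I u -> u = 0.
Proof.
move=> hi hu /idealP[low _]; apply/mpolyP => m; rewrite mcoeff0.
have [mi|ne] := eqVneq (mdeg m) i; first by rewrite low // mi.
exact: dhomog_nemf_coeff hu ne.
Qed.

Lemma X_homog (j : 'I_n) : ('X_j : R) \is 1.-homog.
Proof. by rewrite dhomogX /= mdeg1. Qed.

Lemma socle_comp_high i (a : quot_ring I) : (d < i)%N -> quot_comp i a -> a = 0.
Proof. by move=> hi [u hu ->]; apply/qpi_eq0/(ideal_high hi hu). Qed.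

(** The product of a homogeneous lift with a variable lies in [I] in degree below [d], so it is 0,
    and polynomials form a domain. *)
Lemma socle_comp_low i (a : quot_ring I) : (i < e)%N -> socle_comp i a -> a = 0.
Proof.
move=> hi [soc [u hu aE]]; move: soc; rewrite aE => /in_socleP/(_ (Ordinal n_gt0)).
move/(ideal_low _ (dhomogM hu (X_homog _))).
rewrite addn1 => /(_ hi)/eqP; rewrite mulf_eq0 => /orP[/eqP ->|]; first exact: linear0.
move=> /eqP/(congr1 (mcoeff U_(Ordinal n_gt0))); rewrite mcoeff0 mcoeffX eqxx.
by move/eqP; rewrite oner_eq0.
Qed.

Lemma socle_comp_top (a : quot_ring I) : quot_comp d a -> socle_comp d a.
Proof.
move=> [u hu ->]; split; last by exists u.
apply/in_socleP => j; apply: (@ideal_high d.+1) => //.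
by rewrite -addn1; apply: dhomogM => //; apply: X_homog.
Qed.

(** Everything of degree [d] is in the socle, and [I] meets degree [d] in the kernel of [F], so a
    complement of this kernel models the component. *)
Lemma socle_dim_top : has_dim (@socle_comp k n I d) P.-1.
Proof.
set F := S *m (hypmx sf)^T.
have rF : \rank F = P.-1.
  rewrite -mxrank_tr trmx_mul trmxK mxrankMfree; last first.
    by apply: typemx_tr_free.
  by rewrite (eqnP (hypmx_free sf)) rank_hyp.
have homP u : u \is d.-homog -> I u <-> vec d u *m F = 0.
  exact: ideal_homogP.
have -> : P.-1 = \rank (kermx F)^C%MS.
  rewrite mxrank_compl mxrank_ker rF.
  by have := rank_leq_row F; rewrite rF; lia.
apply: (@has_dim_rowspace k _ (N d) _ (qpi I \o (@pol k n d))) => /=.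
- move=> v _; apply: socle_comp_top; exists (pol v) => //; exact: pol_homog.
- move=> w [_ [u hu ->]].
  have /sub_addsmxP[[x y] /= xy] : (vec d u <= kermx F + (kermx F)^C)%MS.
    by apply: submx_full; apply: addsmx_compl_full.
  exists (y *m (kermx F)^C%MS); first exact: submxMl.
  apply/eqP; rewrite -subr_eq0 -linearB; apply/eqP/qpi_eq0.
  apply/homP; first by rewrite rpredB // pol_homog.
  by rewrite linearB /= polK // xy addrK -mulmxA mulmx_ker mulmx0.
- move=> v vC /qpi_eq0/homP; rewrite pol_homog // polK // => /(_ isT)/sub_kermxP vK.
  by apply/eqP; rewrite -submx0 -(capmx_compl (kermx F)) sub_capmx vK.
Qed.

Lemma narrow_quotient (f : R) : I f -> f \is d.-homog -> f != 0 ->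
  extremely_narrow d I.
Proof.
move=> If hf f0; split.
- exact: (@artinian_quot _ _ _ d ideal_X_high).
- split.
    have [b [bW bfree _]] := socle_dim_top.
    have P1 : (0 < P.-1)%N by have := npartitions_gt0 e; lia.
    exists (b (Ordinal P1)); first exact: bW.
    apply/eqP => b0; have := bfree (fun i => (i == Ordinal P1)%:R).
    rewrite (bigD1 (Ordinal P1)) //= b0 scaler0 big1 ?addr0 => [|i /negPf ->]; last first.
      by rewrite scale0r.
    by move=> /(_ erefl (Ordinal P1))/eqP; rewrite eqxx oner_eq0.
  move=> i a [_ ai] a0; rewrite leqNgt; apply/negP => hi.
  by case/eqP: a0; apply: socle_comp_high ai.
- split; first by exists f.
  move=> i u Iu hu u0; rewrite leqNgt; apply/negP => hi.
  by case/eqP: u0; exact: (ideal_low hi hu Iu).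
- exists (\rank (kermx sf^T)), (perp_basis n (sf := sf)), (\sum_j 'X_j).
  split; first exact: perp_basisP.
    by apply: rpred_sum => j _; apply: X_homog.
  exact: perp_basis_narrow.
Qed.

Hypothesis char0 : [pchar k] =i pred0.
Variable gamma : 'rV[k]_P.
Hypotheses (gammaT : gamma *m (coinvmx k n e)^T = 0)
  (gamma_sf : \sum_l sf 0 l * gamma 0 l != 0).

(** [I] has no nonzero element of degree [e], so the socle component is the kernel of [M^T] itself,
    of dimension [N e] minus the rank of [M]. *)
Lemma socle_dim_sub :
  has_dim (@socle_comp k n I e) (N e - ((n - 1) * P.-1 + npartitions e)).
Proof.
set M := syz_colmx n sf.
have rM : \rank M = ((n - 1) * P.-1 + npartitions e)%N.
  by rewrite (rank_syz_colmx e_gt0 n_gt1 large char0 sum_sf gammaT gamma_sf) rank_hyp.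
have homP u : u \is e.-homog -> (forall j, I (u * 'X_j)) <-> vec e u *m M^T = 0.
  exact: socle_ideal_homogP.
rewrite -rM -[\rank M]mxrank_tr -mxrank_ker.
apply: (@has_dim_rowspace k _ (N e) _ (qpi I \o (@pol k n e))) => /=.
- move=> v /sub_kermxP vM; split; last by exists (pol v) => //; apply: pol_homog.
  by apply/in_socleP/homP; rewrite ?pol_homog // polK.
- move=> w [soc [u hu wE]]; exists (vec e u); last by rewrite vecK.
  by apply/sub_kermxP/homP => //; apply/in_socleP; rewrite -wE.
- move=> v _ /qpi_eq0/(ideal_low (ltnSn e) (pol_homog n_gt0 _)).
  by move/(congr1 (@vec k n e)); rewrite polK // linear0.
Qed.

Lemma socle_poly_quotient :
  is_socle_poly I
    (('C(n + d - 2, d - 1)%:Z - (n%:Z - 1) * (npartitions d)%:Z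
      - (npartitions (d - 1))%:Z + n%:Z - 1) *: 'X^(d - 1)
     + ((npartitions d)%:Z - 1) *: 'X^d).
Proof.
have pos := npartitions_gt0 d.
move=> i; rewrite coefD !coefZ !coefXn subn1 /=.
have [->|id] := eqVneq i d.
  exists P.-1; first exact: socle_dim_top.
  by rewrite (gtn_eqF (ltnSn e)) mulr0 add0r mulr1; lia.
have [->|ie] := eqVneq i e.
  exists (N e - ((n - 1) * P.-1 + npartitions e))%N; first exact: socle_dim_sub.
  (* The rank of [syz_colmx] is at most its number of columns, so the subtraction of natural numbers
     does not truncate. *)
  have le : ((n - 1) * P.-1 + npartitions e <= N e)%N.
    rewrite -(rank_hyp sum_sf) -(rank_syz_colmx e_gt0 n_gt1 large char0 sum_sf gammaT gamma_sf).
    exact: rank_leq_col.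
  have -> : (n + e.+1 - 2 = (n + e).-1)%N by lia.
  by rewrite mulr0 addr0 mulr1 socle_coefE.
exists 0%N; last by rewrite !mulr0 addr0.
apply: has_dim_zero.
  split; last by exists 0; rewrite ?dhomog0 // linear0.
  by move=> b; rewrite mul0r.
move=> a sa; have [lt|] := ltnP i e; first exact: socle_comp_low sa.
by move=> h; apply: (@socle_comp_high i) (sa.2); lia.
Qed.

End Socle.

(** * Choice of the bound on [n] and of the open set *)

Theorem theorem8p1 (d : nat) (hd : (2 <= d)%N) :
  exists n0 : nat, forall (k : fieldType) (n : nat),
    (forall s : seq k, exists x : k, x \notin s) ->
    [pchar k] =i pred0 ->
    (n0 <= n)%N ->
    general_psi d (fun I : ideal {mpoly k[n]} =>
      extremely_narrow d I /\
      is_socle_poly I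
        (('C(n + d - 2, d - 1)%:Z - (n%:Z - 1) * (npartitions d)%:Z
          - (npartitions (d - 1))%:Z + n%:Z - 1) *: 'X^(d - 1)
         + ((npartitions d)%:Z - 1) *: 'X^d)).
Proof.
case: d hd => [//|e] e_gt0; set d := e.+1.
(* [npartitions d * d] variables carry the disjoint representatives, at least one more is the hole,
   and [d.+2] ensures [d.+1 < n]. *)
exists (npartitions d * d + d.+2)%N => k n inf char0 n_ge.
have large : (npartitions d * d < n)%N by lia.
have n_gt1 : (1 < n)%N by lia.
have n_gt0 : (0 < n)%N by lia.
have e_lt_n : (e < n)%N by lia.
have P_lt : (npartitions e < npartitions d)%N.
  by have := npartitions_pred_lt (e_gt0 : (2 <= d)%N); rewrite subn1.
have large' : (npartitions e * e <= n)%N.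
  by apply: leq_trans (ltnW large); rewrite leq_mul // ltnW.
(* [gamma] is fixed before the form, so not being orthogonal to it is an open condition on the
   form. *)
have [gamma gamma0 gammaT] := coinvmx_ker n_gt0 e_lt_n large' char0 P_lt.
have [p [p_homog p_neq0 pP]] := generic_conditions large inf gamma0.
exists (fun c => p.@[c] != 0); split=> //.
  exists (eq p); split=> [q <- //|c _]; split=> [pc|[q <-] //].
  by exists p.
move=> c _ /pP /= [ker_I sum_sf gamma_sf].
set f := general_form c in ker_I sum_sf gamma_sf *.
have f_homog : f \is d.-homog by rewrite /f general_formE pol_homog.
have f_neq0 : f != 0.
  apply: contraNneq sum_sf => ->; rewrite linear0 mul0mx big1 // => l _.
  by rewrite mxE.
have n_ge' : (d.+1 < n)%N by lia.
have idealP := sym_idealP (e_gt0 : (2 <= d)%N) n_ge' f_homog sum_sf ker_I.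
split.
  exact: (narrow_quotient e_gt0 n_gt1 (ltnW large) sum_sf idealP
            (mem_sym_ideal f) f_homog f_neq0).
exact: (socle_poly_quotient e_gt0 n_gt1 (ltnW large) sum_sf idealP char0 gammaT gamma_sf).
Qed.
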